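(* Let \texttt{G-DCST}$^*$ denote the problem \texttt{G-DCST} restricted to instances $(G',D',\ell,2)$ (upper bound function constantly $2$) such that $\ell(e)\in\{0,1\}$ for every $e\in E(G')$ and the maximum in-degree of $D'$ is $\Delta^-(D')=2$. Then there is a polynomial-time reduction from \texttt{FCST} to \texttt{G-DCST}$^*$.
   Context: For a graph $G$ and a digraph $D$ with vertex set $E(G)$, let $\mathrm{dep}(e)=\{e'\in E(G):(e',e)\in E(D)\}$. Given $\ell,u:E(G)\to\mathbb{N}$, a subgraph $H$ of $G$ $(\ell,u)$-satisfies $D$ if $\ell(e)\le|\mathrm{dep}(e)\cap E(H)|\le u(e)$ for every $e\in E(H)$. \texttt{G-DCST} asks, given $(G,D,\ell,u)$, whether $G$ has a spanning tree that $(\ell,u)$-satisfies $D$. \texttt{FCST} (Forcing Constrained Spanning Tree): given a graph $G$ and an undirected graph $D$ with $V(D)=E(G)$, decide whether $G$ has a spanning tree $T$ with $E(T)\cap\{e,f\}\neq\emptyset$ for every edge $ef\in E(D)$. *)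

(* Defs.v *)
From mathcomp Require Import all_boot.
Set Implicit Arguments. Unset Strict Implicit. Unset Printing Implicit Defensive.

(* Computation model: deterministic single-tape Turing machines over   *)
(* the tape alphabet {blank, 1, #} = option bool                       *)
(* (Some true = '1', Some false = '#', None = blank).                  *)
Definition sym := option bool.

Record TM := {
  nst : nat;
  st0 : 'I_nst;
  (* transition: None = halt; Some (q', written symbol, move right?) *)
  delta : 'I_nst -> sym -> option ('I_nst * sym * bool)
}.

(* configuration: state, tape left of head (nearest cell first), head cell,
   tape right of head *)
Definition config (M : TM) := ('I_(nst M) * seq sym * sym * seq sym)%type.

Definition step (M : TM) (c : config M) : option (config M) :=
  let: (q, l, h, r) := c in
  match delta q h with
  | None => None
  | Some (q', w, mvR) =>
      if mvR then Some (q', w :: l, head None r, behead r)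
      else Some (q', behead l, head None l, w :: r)
  end.

Fixpoint exec (M : TM) (t : nat) (c : config M) : config M :=
  match t with
  | 0 => c
  | t'.+1 => match step c with None => c | Some c' => exec t' c' end
  end.

Definition halted (M : TM) (c : config M) : bool :=
  if step c is None then true else false.

Definition init (M : TM) (x : seq bool) : config M :=
  (st0 M, [::], head None (map Some x), behead (map Some x)).

Fixpoint takeSome (s : seq sym) : seq bool :=
  match s with Some b :: s' => b :: takeSome s' | _ => [::] end.

Definition output (M : TM) (c : config M) : seq bool :=
  let: (_, _, h, r) := c in takeSome (h :: r).

Definition poly_time_computable (f : seq bool -> seq bool) : Prop :=
  exists (M : TM) (c d : nat), forall x : seq bool,
    halted (exec (c * size x ^ d + c) (init M x)) /\
    output (exec (c * size x ^ d + c) (init M x)) = f x.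

Definition enc_nat (k : nat) : seq bool := rcons (nseq k true) false.
Definition enc_seq (s : seq nat) : seq bool := flatten (map enc_nat s).
Definition pairs_flat (ps : seq (nat * nat)) : seq nat :=
  flatten (map (fun p => [:: p.1; p.2]) ps).

(* Graphs: a (finite simple) graph on vertex set {0,..,n-1} given by a *)
(* list E of edges; edge i is nth E i.  Subgraphs spanning all         *)
(* vertices are given by a bit mask m over the edge indices.           *)
Definition simple_graph (n : nat) (E : seq (nat * nat)) : bool :=
  all (fun p => [&& p.1 < n, p.2 < n & p.1 != p.2]) E &&
  uniq (map (fun p => (minn p.1 p.2, maxn p.1 p.2)) E).

Definition joins (E : seq (nat * nat)) (i u v : nat) : bool :=
  let p := nth (0, 0) E i in
  ((p.1 == u) && (p.2 == v)) || ((p.1 == v) && (p.2 == u)).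

Definition adj (n : nat) (E : seq (nat * nat)) (m : bitseq) : rel 'I_n :=
  fun u v => has (fun i => nth false m i && joins E i u v) (iota 0 (size E)).

Definition spanning_tree (n : nat) (E : seq (nat * nat)) (m : bitseq) : Prop :=
  [/\ size m = size E,
      forall u v : 'I_n, connect (@adj n E m) u v &
      forall s : seq 'I_n, uniq s -> 2 < size s -> ~~ cycle (@adj n E m) s].

Record FInst := { fn : nat; fE : seq (nat * nat); fD : seq (nat * nat) }.

(* G simple graph; D simple undirected graph on vertex set E(G) (indices) *)
Definition FInst_wf (I : FInst) : bool :=
  simple_graph (fn I) (fE I) && simple_graph (size (fE I)) (fD I).

Definition FCST_yes (I : FInst) : Prop :=
  exists m, spanning_tree (fn I) (fE I) m /\
    forall p, p \in fD I -> nth false m p.1 || nth false m p.2.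

Definition encF (I : FInst) : seq bool :=
  enc_seq ([:: fn I; size (fE I)] ++ pairs_flat (fE I) ++
           size (fD I) :: pairs_flat (fD I)).

Definition FCST_valid (x : seq bool) : Prop :=
  exists I, FInst_wf I /\ x = encF I.
Definition FCST_lang (x : seq bool) : Prop :=
  exists I, [/\ FInst_wf I, x = encF I & FCST_yes I].

(* gA : arcs (e', e) of the digraph D on E(G); gl, gu : lower/upper bounds *)
Record GInst := { gn : nat; gE : seq (nat * nat); gA : seq (nat * nat);
                  gl : seq nat; gu : seq nat }.

Definition GInst_wf (I : GInst) : bool :=
  [&& simple_graph (gn I) (gE I),
      all (fun a => [&& a.1 < size (gE I), a.2 < size (gE I) & a.1 != a.2]) (gA I),
      uniq (gA I),
      size (gl I) == size (gE I) &
      size (gu I) == size (gE I)].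

Definition indeg (I : GInst) (e : nat) : nat := count (fun a => a.2 == e) (gA I).

Definition dep_count (I : GInst) (m : bitseq) (e : nat) : nat :=
  count (fun a => (a.2 == e) && nth false m a.1) (gA I).

Definition satisfies (I : GInst) (m : bitseq) : Prop :=
  forall e, e < size (gE I) -> nth false m e ->
    nth 0 (gl I) e <= dep_count I m e <= nth 0 (gu I) e.

Definition GDCST_yes (I : GInst) : Prop :=
  exists m, spanning_tree (gn I) (gE I) m /\ satisfies I m.

Definition star_restr (I : GInst) : bool :=
  [&& all (fun k => k == 2) (gu I), all (fun k => k <= 1) (gl I),
      all (fun e => indeg I e <= 2) (iota 0 (size (gE I))) &
      has (fun e => indeg I e == 2) (iota 0 (size (gE I)))].

Definition encG (I : GInst) : seq bool :=
  enc_seq ([:: gn I; size (gE I)] ++ pairs_flat (gE I) ++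
           size (gA I) :: pairs_flat (gA I) ++ gl I ++ gu I).

Definition GDCSTstar_valid (x : seq bool) : Prop :=
  exists I, [/\ GInst_wf I, star_restr I & x = encG I].
Definition GDCSTstar_lang (x : seq bool) : Prop :=
  exists I, [/\ GInst_wf I, star_restr I, x = encG I & GDCST_yes I].

(* Main.v *)
(* Hang [|E(D)| + 3] pendant edges on vertex 0 of [G] (an empty [G] is first given
   one vertex).  Pendant edges lie in every spanning tree, so a pendant edge [g]
   with [l(g) = 1] and [dep(g) = {e, f}] forces the tree to meet [{e, f}]: there is
   one such edge for each edge [ef] of [D].  Of the other three, the first two are
   the dependencies of the third, which makes the maximum in-degree equal to 2 even
   if [D] has no edge.

   For the running time, a machine with finitely many stacks is simulated on one
   tape by storing the stacks in blank-separated segments: a push or a pop shifts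
   the part of the tape to its right by one cell, hence costs linear time.  The
   reduction is a structured program on nine stacks, and its cost is bounded on
   every input, an input that ends prematurely being read as if it continued with
   zeros. *)
From HB Require Import structures.
Require Import Defs.
From mathcomp Require Import all_boot zify.
Set Implicit Arguments. Unset Strict Implicit. Unset Printing Implicit Defensive.

(** * Turing machines up to trailing blanks *)


(** [poly_time_computable] demands the output [f x] in time on every bit string, even one that
    encodes no instance. The reduction is therefore a total function on raw bits, [reduction], read
    off from the program; that it sends [encF I] to [encG (red I)] is a separate statement. The
    header counts of the new instance depend on the number of edges of [D], which the input gives
    only after the edges of [G], and a stack shows first what was pushed last. Hence lists are
    accumulated in reverse and the output is assembled from its end to its front. The extra pendant
    edge with two dependencies is produced by prepending to [D] the pair of the other two. As these
    lie in every spanning tree, the new pair is always met, and one loop treats all pairs alike. The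
    upper bound 2 is met automatically, since no edge has more than two dependencies: the lower
    bounds carry the constraint. *)

Definition tape_eq (s t : seq sym) := nth None s =1 nth None t.

Lemma tape_eq_cons a s t : tape_eq s t -> tape_eq (a :: s) (a :: t).
Proof. by move=> e [|i] //=; apply: e. Qed.

Lemma tape_eq_behead s t : tape_eq s t -> tape_eq (behead s) (behead t).
Proof. by move=> e i; rewrite !nth_behead. Qed.

Lemma tape_eq_head s t : tape_eq s t -> head None s = head None t.
Proof. by rewrite -!nth0; apply. Qed.

Lemma tape_eq_takeSome s t : tape_eq s t -> takeSome s = takeSome t.
Proof.
elim: s t => [|a s IH] [|b t] //= e.
- by case: b e => // b /(_ 0).
- by case: a e => // a /(_ 0).
have <- : a = b by exact: (e 0).
by case: a e => // a e; rewrite (IH t) // => i; exact: (e i.+1).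
Qed.

(** The scanned cell is the first one of the right part, so that a block of tape starting at the
    head is simply a prefix. *)
Definition tconf (Q : Type) := (Q * seq sym * seq sym)%type.

Definition tstep (Q : Type) (d : Q -> sym -> option (Q * sym * bool))
    (c : tconf Q) : option (tconf Q) :=
  let: (q, l, r) := c in
  match d q (head None r) with
  | None => None
  | Some (q', w, mvR) =>
      if mvR then Some (q', w :: l, behead r)
      else Some (q', behead l, head None l :: w :: behead r)
  end.

Definition conf_eq (Q : Type) (c c' : tconf Q) :=
  [/\ c.1.1 = c'.1.1, tape_eq c.1.2 c'.1.2 & tape_eq c.2 c'.2].

(** The base case is taken up to trailing blanks: moving past an end of the tape creates explicit
    blanks, and runs must still compose. *)
Inductive tsteps (Q : Type) (d : Q -> sym -> option (Q * sym * bool)) :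
    nat -> tconf Q -> tconf Q -> Prop :=
| tsteps0 c c' of conf_eq c c' : tsteps d 0 c c'
| tstepsS n c c1 c' of tstep d c = Some c1 & tsteps d n c1 c' :
    tsteps d n.+1 c c'.

Lemma conf_eq_trans Q (a b c : tconf Q) :
  conf_eq a b -> conf_eq b c -> conf_eq a c.
Proof.
case=> e1 e2 e3 [f1 f2 f3]; split; first exact: etrans e1 f1.
- by move=> i; rewrite e2 f2.
- by move=> i; rewrite e3 f3.
Qed.

Lemma tstep_conf_eq Q d (c c' c1 : tconf Q) : conf_eq c c' ->
  tstep d c' = Some c1 -> exists2 c2, tstep d c = Some c2 & conf_eq c2 c1.
Proof.
case: c c' => [[q l] r] [[q' l'] r'] [/= -> el er].
rewrite (tape_eq_head er); case: (d q' _) => [[[p w] []]|] //= [<-].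
- eexists; first by [].
  by split=> //=; [exact: tape_eq_cons|exact: tape_eq_behead].
- eexists; first by [].
  split=> //=; first exact: tape_eq_behead.
  rewrite (tape_eq_head el); do 2!apply: tape_eq_cons; exact: tape_eq_behead.
Qed.

Lemma tsteps_conf_eq Q d n (c c0 c' : tconf Q) :
  conf_eq c c0 -> tsteps d n c0 c' -> tsteps d n c c'.
Proof.
move=> e H; elim: H c e => {n c0 c'} [c0 c' e' c e|n c0 c1 c' s1 _ IH c e].
  exact/tsteps0/(conf_eq_trans e).
have [c2 s2 e2] := tstep_conf_eq e s1; exact: tstepsS s2 (IH _ e2).
Qed.

Lemma tsteps_trans Q d n m (a b c : tconf Q) :
  tsteps d n a b -> tsteps d m b c -> tsteps d (n + m) a c.
Proof.
move=> H; elim: H c => {n a b} [a b e c|n a a1 b s1 _ IH c /IH].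
  exact: tsteps_conf_eq.
exact: tstepsS.
Qed.

Lemma tsteps_conf_eqr Q d n (a b c : tconf Q) :
  tsteps d n a b -> conf_eq b c -> tsteps d n a c.
Proof. by move=> H e; rewrite -[n]addn0; apply: tsteps_trans H (tsteps0 _ e). Qed.

Lemma tsteps_refl Q d (c : tconf Q) : tsteps d 0 c c.
Proof. exact: tsteps0. Qed.

Definition mkTM (Q : finType) (q0 : Q)
    (d : Q -> sym -> option (Q * sym * bool)) : TM :=
  {| nst := #|Q|; st0 := enum_rank q0;
     delta := fun i s =>
       omap (fun p => (enum_rank p.1.1, p.1.2, p.2)) (d (enum_val i) s) |}.

Lemma execS (M : TM) t (c : config M) :
  exec t.+1 c = if step c is Some c' then exec t c' else c.
Proof. by []. Qed.

(** Both models move in step, and [exec] stays put once halted, so any time [T] beyond [n] gives the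
    same result. *)
Lemma exec_tsteps (Q : finType) q0 (d : Q -> sym -> option (Q * sym * bool))
    n (c0 c1 : tconf Q) T q l h r :
  tsteps d n c0 c1 -> d c1.1.1 (head None c1.2) = None ->
  n <= T -> conf_eq (q, l, h :: r) c0 ->
  let c := exec T ((enum_rank q, l, h, r) : config (mkTM q0 d)) in
  halted c /\ output c = takeSome c1.2.
Proof.
move=> H; elim: H T q l h r => {n c0 c1}
  [c0 c1 e T q l h r dN _ e0|n c0 c1 c' s1 _ IH T q l h r dN].
  have [/= e1 e2 e3] := conf_eq_trans e0 e.
  have sN : step ((enum_rank q, l, h, r) : config (mkTM q0 d)) = None.
    by rewrite /= enum_rankK e1 (tape_eq_head e3 : h = _) dN.
  have -> : exec T ((enum_rank q, l, h, r) : config (mkTM q0 d)) =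
            (enum_rank q, l, h, r) by case: T => // T; rewrite execS sN.
  by rewrite /halted sN; split=> //; apply: tape_eq_takeSome.
case: T => // T; rewrite ltnS => leT e0.
have [[[p l1] r1] s2 e2] := tstep_conf_eq e0 s1.
suff [h1 [r2 [sE e3]]] : exists h1 r2,
    step ((enum_rank q, l, h, r) : config (mkTM q0 d)) =
      Some (enum_rank p, l1, h1, r2) /\ conf_eq (p, l1, h1 :: r2) (p, l1, r1).
  cbv zeta; rewrite execS sE.
  exact: IH dN leT (conf_eq_trans e3 e2).
move: s2 => /=; rewrite enum_rankK.
case: (d q h) => [[[p' w] []]|] //= [<- <- <-].
- exists (head None r), (behead r); split=> //.
  by split=> //= -[|i]; rewrite /= ?nth0 ?nth_behead.
- by exists (head None l), (w :: r).
Qed.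

(** * Stacks on a tape *)


Notation stacks := (seq (seq bool)).

Definition upd (ss : stacks) (i : nat) (s : seq bool) : stacks :=
  take i ss ++ s :: drop i.+1 ss.

(* The target of a jump is [None] when the program exits. *)
Inductive instr (T : Type) : Type :=
| IPush of nat & bool & T
| IPop of nat & T & T & T.

Definition instr_idx T (a : instr T) : nat :=
  match a with IPush i _ _ => i | IPop i _ _ _ => i end.

Definition instr_step T (a : instr T) (ss : stacks) : T * stacks :=
  match a with
  | IPush i b t => (t, upd ss i (b :: nth [::] ss i))
  | IPop i te t1 t0 =>
      match nth [::] ss i with
      | [::] => (te, ss)
      | b :: s => (if b then t1 else t0, upd ss i s)
      end
  end.

Fixpoint srun (Q : Type) (prog : Q -> instr (option Q)) (t : nat)
    (c : option Q * stacks) : option Q * stacks :=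
  match t, c with
  | t'.+1, (Some q, ss) => srun prog t' (instr_step (prog q) ss)
  | _, _ => c
  end.

Inductive mode := Skip | Ins | End | Back | Fwd | Del.

Definition mode_code (m : mode) : bool * bool * bool :=
  match m with
  | Skip => (false, false, false) | Ins => (false, false, true)
  | End => (false, true, false) | Back => (false, true, true)
  | Fwd => (true, false, false) | Del => (true, false, true)
  end.

Definition mode_decode (c : bool * bool * bool) : mode :=
  match c with
  | (false, false, false) => Skip | (false, false, true) => Ins
  | (false, true, false) => End | (false, true, true) => Back
  | (true, false, false) => Fwd | _ => Del
  end.

Lemma mode_codeK : cancel mode_code mode_decode. Proof. by case. Qed.

HB.instance Definition _ := Finite.copy mode (can_type mode_codeK).

(** Program point, phase, number of blanks still to be crossed, and the symbol carried along by a
    shift. *)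
Definition sim_state (K : nat) (Q : Type) :=
  (option Q * mode * 'I_K.+1 * sym)%type.

(* The stacks occupy consecutive tape segments, tops to the left, each followed
   by a blank; between two instructions the head is on the first cell.  An
   instruction on stack [i] skips [i] blanks, inserts ([Ins]) or deletes
   ([Fwd] to the last blank, then [Del]) one cell by shifting all that follows,
   and counts blanks back ([Back]) to the left end. *)
Definition sim_home K Q (prog : Q -> instr (option Q)) (oq : option Q) :
    sim_state K Q :=
  (oq, Skip, inord (if oq is Some q then instr_idx (prog q) else 0), None).

(** After all counted blanks, the next blank is the cell to the left of the first segment, which
    marks the home position. *)
Definition sim_back K Q (prog : Q -> instr (option Q)) oq (c : nat) (s : sym) :
    option (sim_state K Q * sym * bool) :=
  if s is Some _ then Some ((oq, Back, inord c, None), s, false) else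
  if c is c'.+1 then Some ((oq, Back, inord c', None), s, false)
  else Some (sim_home K prog oq, s, true).

Definition sim_ins K Q (q : Q) (c : nat) (y s : sym) :
    option (sim_state K Q * sym * bool) :=
  if s is Some _ then Some ((Some q, Ins, inord c, s), y, true) else
  if c is c'.+1 then Some ((Some q, Ins, inord c', s), y, true)
  (* The displaced final blank is not written: the cell beyond the last segment is already blank. *)
  else Some ((Some q, End, inord 0, None), y, true).

Definition sim_fwd K Q (q : Q) (i c : nat) (s : sym) :
    option (sim_state K Q * sym * bool) :=
  if s is Some _ then Some ((Some q, Fwd, inord c, None), s, true) else
  if c is c'.+1 then Some ((Some q, Fwd, inord c', None), s, true)
  else Some ((Some q, Del, inord (K.-1 - i), None), None, false).

Definition sim_del K Q (prog : Q -> instr (option Q)) q i (t1 t0 : option Q)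
    (c : nat) (y s : sym) : option (sim_state K Q * sym * bool) :=
  if s is Some _ then Some ((Some q, Del, inord c, s), y, false) else
  if c is c'.+1 then Some ((Some q, Del, inord c', s), y, false)
  (* This blank lies just before stack [i], so the symbol still carried is the popped top; the same
     blank is the first one read on the way back. *)
  else sim_back K prog (if y == Some true then t1 else t0) i s.

Definition sim_delta K Q (prog : Q -> instr (option Q)) (st : sim_state K Q)
    (s : sym) : option (sim_state K Q * sym * bool) :=
  let: (oq, m, c, y) := st in
  match m, oq with
  | Back, _ => sim_back K prog oq c s
  | _, None => None
  | Skip, Some q =>
      if (c : nat) is c'.+1 then
        Some ((oq, Skip, inord (if s is None then c' else c'.+1), None), s, true)
      else match prog q with
      | IPush i b _ => sim_ins K q (K.-1 - i) (Some b) s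
      | IPop i te _ _ =>
          if s is Some _ then sim_fwd K q i (K.-1 - i) s
          else Some ((te, Back, inord i, None), s, false)
      end
  | Ins, Some q => sim_ins K q c y s
  | End, Some q =>
      if prog q is IPush _ _ t then Some ((t, Back, inord K.-1, None), s, false)
      else None
  | Fwd, Some q => sim_fwd K q (instr_idx (prog q)) c s
  | Del, Some q =>
      if prog q is IPop i _ t1 t0 then sim_del K prog q i t1 t0 c y s else None
  end.

(** * Single passes of the head *)

Lemma sim_back_steps K Q prog oq L c rr : c <= K -> count_mem None L = c ->
  tsteps (@sim_delta K Q prog) (size L).+1
    ((oq, Back, inord c, None), behead L, head None L :: rr)
    (sim_home K prog oq, [::], catrev L rr).
Proof.
elim: L c rr => [|x L IH] c rr cK /= cE.
  apply: tstepsS; first by rewrite /= -cE inordK.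
  by apply/tsteps0; split=> //= -[|[]].
case: x cE => [b|] /=; rewrite ?add0n ?add1n => cE.
  apply: tstepsS; first by rewrite /= inordK.
  exact: IH.
case: c cK cE => // c cK [cE]; apply: tstepsS; first by rewrite /= inordK.
exact: IH (ltnW cK) cE.
Qed.

Lemma count_last (x y : sym) A :
  last x (y :: A) = None -> 0 < count_mem None (y :: A).
Proof. by rewrite -has_count has_pred1 /= => {1}<-; apply: mem_last. Qed.

Lemma sim_skip_steps K Q prog (q : Q) A c l rr : c <= K ->
  count_mem None A = c -> last None A = None ->
  tsteps (@sim_delta K Q prog) (size A)
    ((Some q, Skip, inord c, None), l, A ++ rr)
    ((Some q, Skip, inord 0, None), catrev A l, rr).
Proof.
elim: A c l => [|x A IH] c l cK; first by move=> <- _; apply: tsteps_refl.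
case: c cK => [|c] cK.
  by move=> cE /count_last; rewrite cE.
case: x => [b|] /=; rewrite ?add0n ?add1n => cE eN.
  apply: tstepsS; first by rewrite /= inordK.
  by apply: IH => //; case: A eN cE.
case: cE => cE; apply: tstepsS; first by rewrite /= inordK.
by apply: IH => //; apply: ltnW.
Qed.

Lemma sim_ins_steps K Q prog (q : Q) A c y l : c <= K ->
  count_mem None A = c.+1 -> last (Some true) A = None ->
  tsteps (@sim_delta K Q prog) (size A)
    ((Some q, Ins, inord c, y), l, A)
    ((Some q, End, inord 0, None), catrev (belast y A) l, [::]).
Proof.
elim: A c y l => [|x A IH] c y l cK //.
case: x => [b|] /=; rewrite ?add0n ?add1n => cE eN.
  apply: tstepsS; first by rewrite /= inordK.
  by apply: IH => //; case: (A) eN cE.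
case: cE => cE; case: c cK cE => [|c] cK cE.
  case: A {IH} cE eN => [_ _|x A cE eN].
    by apply: tstepsS; [rewrite /= inordK|apply: tsteps_refl].
  by move: (@count_last None x A eN); rewrite cE.
apply: tstepsS; first by rewrite /= inordK.
by apply: IH => //; [apply: ltnW|case: (A) eN cE].
Qed.

Lemma sim_fwd_steps K Q prog (q : Q) A c l rr : c <= K ->
  count_mem None A = c ->
  tsteps (@sim_delta K Q prog) (size A)
    ((Some q, Fwd, inord c, None), l, A ++ rr)
    ((Some q, Fwd, inord 0, None), catrev A l, rr).
Proof.
elim: A c l => [|x A IH] c l cK; first by move=> <-; apply: tsteps_refl.
case: x => [b|] /=; rewrite ?add0n ?add1n => cE.
  apply: tstepsS; first by rewrite /= inordK.
  exact: IH.
case: c cK cE => // c cK [cE]; apply: tstepsS; first by rewrite /= inordK.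
by apply: IH => //; apply: ltnW.
Qed.

Lemma sim_del_steps K Q prog (q : Q) i te t1 t0 L c y L' rr :
  prog q = IPop i te t1 t0 -> c <= K -> count_mem None L = c ->
  tsteps (@sim_delta K Q prog) (size L)
    ((Some q, Del, inord c, y), behead (L ++ L'), head None (L ++ L') :: rr)
    ((Some q, Del, inord 0, last y L), behead L',
     head None L' :: catrev (belast y L) rr).
Proof.
move=> pq; elim: L c y rr => [|x L IH] c y rr cK.
  by move=> <-; apply: tsteps_refl.
case: x => [b|] /=; rewrite ?add0n ?add1n => cE.
  apply: tstepsS; first by rewrite /= pq inordK.
  exact: IH.
case: c cK cE => // c cK [cE]; apply: tstepsS; first by rewrite /= pq inordK.
by apply: IH => //; apply: ltnW.
Qed.

Definition flat (ss : stacks) : seq sym :=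
  flatten [seq rcons (map Some s) None | s <- ss].

Lemma flat_cat s1 s2 : flat (s1 ++ s2) = flat s1 ++ flat s2.
Proof. by rewrite /flat map_cat flatten_cat. Qed.

Lemma flat_cons s ss : flat (s :: ss) = map Some s ++ None :: flat ss.
Proof. by rewrite /flat /= cat_rcons. Qed.

Lemma count_flat ss : count_mem None (flat ss) = size ss.
Proof.
elim: ss => // s ss IH; rewrite flat_cons count_cat /= IH.
by rewrite count_map (@eq_count _ _ pred0) ?count_pred0.
Qed.

Lemma last_flat x s ss : last x (flat (s :: ss)) = None.
Proof.
elim: ss s x => [|t ss IH] s x; first by rewrite flat_cons last_cat.
by rewrite flat_cons last_cat last_cons IH.
Qed.

(** Having reached its target, [Skip] already performs the first move of the next phase. It thus
    shares its successor with a configuration of that phase, to which the lemma on the pass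
    applies. *)
Lemma tsteps_same_step Q (d : Q -> sym -> option (Q * sym * bool)) n c c0 c' :
  tstep d c = tstep d c0 -> tsteps d n.+1 c0 c' -> tsteps d n.+1 c c'.
Proof.
move=> e H; inversion H; subst; apply: tstepsS; last by eassumption.
by rewrite e.
Qed.

Lemma split_stacks (ss : stacks) i : i < size ss ->
  ss = take i ss ++ nth [::] ss i :: drop i.+1 ss.
Proof. by move=> lti; rewrite -drop_nth // cat_take_drop. Qed.

Lemma sim_push_steps K Q prog (q : Q) i b t ss :
  prog q = IPush i b t -> size ss = K -> i < K ->
  exists2 n, n <= 2 * size (flat ss) + 3 &
    tsteps (@sim_delta K Q prog) n
      (sim_home K prog (Some q), [::], flat ss)
      (sim_home K prog t, [::], flat (upd ss i (b :: nth [::] ss i))).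
Proof.
move=> pq sK iK.
have iss : i < size ss by rewrite sK.
set A := flat (take i ss); set B := flat (drop i ss).
have ssE : flat ss = A ++ B by rewrite -flat_cat cat_take_drop.
have sA : count_mem None A = i by rewrite count_flat size_takel // ltnW.
have sB : count_mem None B = K - i by rewrite count_flat size_drop sK.
have lA : last None A = None by rewrite /A; case: (take i ss) => // *; rewrite last_flat.
have BE : B = map Some (nth [::] ss i) ++ None :: flat (drop i.+1 ss).
  by rewrite -flat_cons -drop_nth.
have lB x : last x B = None by rewrite /B (drop_nth [::] iss) last_flat.
have sB0 : 0 < size B by rewrite BE size_cat addnS.
exists (size A + (size B + (1 + (size (catrev (belast (Some b) B) (catrev A [::]))).+1))).
  rewrite ssE !catrevE !size_cat !size_rev size_belast /=.
  by clear; move: (size A) (size B) => *; lia.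
apply: tsteps_trans.
  by rewrite ssE /sim_home /= pq; apply: sim_skip_steps => //=; apply: ltnW.
apply: tsteps_trans.
  case sBE: (size B) => [|m]; first by rewrite sBE in sB0.
  apply: (@tsteps_same_step _ _ _ _
    ((Some q, Ins, inord (K.-1 - i), Some b), catrev A [::], B)).
    rewrite /= pq !inordK //; lia.
  rewrite -sBE; apply: sim_ins_steps; [lia | rewrite sB; lia | exact: lB].
apply: tsteps_trans.
  by apply: tstepsS; [rewrite /= pq|apply: tsteps_refl].
apply: tsteps_conf_eqr.
  apply: sim_back_steps; first lia.
  rewrite !catrevE cats0 count_cat !count_rev sA.
  have := congr1 (count_mem None) (lastI (Some b) B).
  rewrite lB -cats1 count_cat /= sB; lia.
split=> //= j; congr (nth _ _ j).
have -> : flat (upd ss i (b :: nth [::] ss i)) = A ++ Some b :: B.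
  by rewrite /upd flat_cat flat_cons BE.
rewrite !catrevE cats0 rev_cat !revK -catA; congr (_ ++ _).
by rewrite [RHS]lastI lB cats1.
Qed.

Lemma sim_pop_empty_steps K Q prog (q : Q) i te t1 t0 ss :
  prog q = IPop i te t1 t0 -> size ss = K -> i < K -> nth [::] ss i = [::] ->
  exists2 n, n <= 2 * size (flat ss) + 3 &
    tsteps (@sim_delta K Q prog) n
      (sim_home K prog (Some q), [::], flat ss)
      (sim_home K prog te, [::], flat ss).
Proof.
move=> pq sK iK nE.
have iss : i < size ss by rewrite sK.
set A := flat (take i ss).
have ssE : flat ss = A ++ None :: flat (drop i.+1 ss).
  by rewrite {1}(split_stacks iss) nE flat_cat flat_cons.
have sA : count_mem None A = i by rewrite count_flat size_takel // ltnW.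
have lA : last None A = None by rewrite /A; case: (take i ss) => // *; rewrite last_flat.
exists (size A + (1 + (size (catrev A [::])).+1)).
  rewrite ssE catrevE cats0 size_rev size_cat /=.
  by clear; move: (size A) => *; lia.
apply: tsteps_trans.
  by rewrite ssE /sim_home /= pq; apply: sim_skip_steps => //=; apply: ltnW.
apply: tsteps_trans.
  by apply: tstepsS; [rewrite /= pq inordK|apply: tsteps_refl].
apply: tsteps_conf_eqr.
  by apply: sim_back_steps; [apply: ltnW|rewrite catrevE cats0 count_rev].
by split=> //= j; rewrite ssE !catrevE cats0 revK.
Qed.

Lemma sim_pop_steps K Q prog (q : Q) i te t1 t0 ss b s :
  prog q = IPop i te t1 t0 -> size ss = K -> i < K -> nth [::] ss i = b :: s ->
  exists2 n, n <= 3 * size (flat ss) + 3 &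
    tsteps (@sim_delta K Q prog) n
      (sim_home K prog (Some q), [::], flat ss)
      (sim_home K prog (if b then t1 else t0), [::], flat (upd ss i s)).
Proof.
move=> pq sK iK nE.
have iss : i < size ss by rewrite sK.
set A := flat (take i ss).
have sA : count_mem None A = i by rewrite count_flat size_takel // ltnW.
have lA : last None A = None by rewrite /A; case: (take i ss) => // *; rewrite last_flat.
have [B BE] : exists B, flat (s :: drop i.+1 ss) = rcons B None.
  case/lastP: (flat _) (last_flat (Some true) s (drop i.+1 ss)) => // B x.
  by rewrite last_rcons => ->; exists B.
have ssE : flat ss = A ++ Some b :: rcons B None.
  by rewrite {1}(split_stacks iss) nE flat_cat flat_cons -BE flat_cons.
have sB : count_mem None B = K.-1 - i.
  have := count_flat (s :: drop i.+1 ss).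
  rewrite BE -cats1 count_cat /= size_drop sK; move: (count_mem _ _) => *; lia.
set L' := catrev A [::].
have LE : catrev B (Some b :: L') = rcons (rev B) (Some b) ++ L'.
  by rewrite catrevE cat_rcons.
exists (size A + ((size B).+1 + (1 + ((size B).+1 + (size L').+1)))).
  rewrite ssE /L' catrevE cats0 size_rev size_cat /= size_rcons.
  by clear; move: (size A) (size B) => *; lia.
apply: tsteps_trans.
  by rewrite ssE /sim_home /= pq; apply: sim_skip_steps => //=; apply: ltnW.
apply: tsteps_trans.
  apply: (@tsteps_same_step _ _ _ _
    ((Some q, Fwd, inord (K.-1 - i), None), L', (Some b :: B) ++ [:: None])).
    rewrite /= cats1 pq !inordK //; lia.
  apply: (@sim_fwd_steps _ _ _ _ (Some b :: B)) => //; lia.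
apply: tsteps_trans.
  by apply: tstepsS; [rewrite /= pq inordK|apply: tsteps_refl].
apply: tsteps_trans.
  rewrite /= LE -(size_rev B) -(size_rcons _ (Some b)).
  apply: sim_del_steps pq _ _; first lia.
  by rewrite -cats1 count_cat count_rev sB addn0.
rewrite last_rcons belast_rcons.
apply: (@tsteps_same_step _ _ _ _
  ((if b then t1 else t0, Back, inord i, None), behead L',
    head None L' :: catrev (None :: rev B) [:: None])).
  have -> : head None L' = None.
    rewrite /L' catrevE cats0; case/lastP: (A) lA => // A' x.
    by rewrite last_rcons rev_rcons => ->.
  by rewrite /= pq !inordK //; case: b {nE ssE LE} => //; lia.
apply: tsteps_conf_eqr.
  by apply: sim_back_steps; [apply: ltnW|rewrite /L' catrevE cats0 count_rev].
split=> //= j; rewrite /upd flat_cat BE /L' !catrevE cats0 !revK !nth_cat.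
case: ltnP => // _; rewrite nth_rcons.
case: ltngtP => //; rewrite -/(size B).
- by rewrite -subn_gt0; case: (_ - size B) => // -[|[]].
- by move=> ->; rewrite subnn.
Qed.

(** * Structured stack programs *)


Lemma size_upd ss i s : i < size ss -> size (upd ss i s) = size ss.
Proof.
by move=> lti; rewrite /upd size_cat /= size_takel 1?ltnW // size_drop; lia.
Qed.

Lemma size_flat_upd ss i s : i < size ss ->
  size (flat (upd ss i s)) + size (nth [::] ss i) = size (flat ss) + size s.
Proof.
move=> lti; rewrite {3}(split_stacks lti) /upd !flat_cat !flat_cons.
rewrite !size_cat /= !size_map; lia.
Qed.

(** An instruction lengthens the tape by at most one cell, so the tape never exceeds
    [size (flat ss) + t] cells, and this bounds the cost of each of the [t] instructions. *)
Lemma sim_run K Q prog t (oq : option Q) ss ss' :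
  (forall q, instr_idx (prog q) < K) -> size ss = K ->
  srun prog t (oq, ss) = (None, ss') ->
  exists2 n, n <= t * (3 * (size (flat ss) + t) + 3) &
    tsteps (@sim_delta K Q prog) n
      (sim_home K prog oq, [::], flat ss) (sim_home K prog None, [::], flat ss').
Proof.
move=> wf; elim: t oq ss => [|t IH] [q|] ss sK //=.
- by case=> <-; exists 0; rewrite ?mul0n //; apply: tsteps_refl.
- case E: (instr_step (prog q) ss) => [oq1 ss1] /IH H.
  suff [s1 [s2 [n1 n1le st1]]] : size ss1 = K /\
      size (flat ss1) <= (size (flat ss)).+1 /\
      exists2 n1, n1 <= 3 * size (flat ss) + 3 &
        tsteps (@sim_delta K Q prog) n1
          (sim_home K prog (Some q), [::], flat ss)
          (sim_home K prog oq1, [::], flat ss1).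
    have [n2 n2le st2] := H s1.
    exists (n1 + n2); last exact: tsteps_trans st1 st2.
    rewrite mulSn; apply: leq_add; first lia.
    by apply: leq_trans n2le _; apply: leq_mul => //; lia.
  have := wf q; case pq: (prog q) => [i b t'|i te t1 t0] /= iK; move: E; rewrite pq /=.
    case=> <- <-; split; first by rewrite size_upd sK.
    split.
      have /= := @size_flat_upd ss i (b :: nth [::] ss i); rewrite sK => /(_ iK).
      move: (size _) (size _) (size _) => *; lia.
    have [n nle st] := sim_push_steps pq sK iK; exists n => //.
    apply: leq_trans nle _; move: (size _) => *; lia.
  case nE: (nth [::] ss i) => [|b s] [<- <-].
    split=> //; split=> //.
    have [n nle st] := sim_pop_empty_steps pq sK iK nE; exists n => //.
    apply: leq_trans nle _; move: (size _) => *; lia.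
  split; first by rewrite size_upd sK.
  split; last exact: sim_pop_steps pq sK iK nE.
  have /= := @size_flat_upd ss i s; rewrite sK nE => /(_ iK) /=.
  move: (size _) (size _) (size _) => *; lia.
- by case=> <-; exists 0 => //; apply: tsteps_refl.
Qed.

Lemma flat_nseq K : flat (nseq K [::]) = nseq K None.
Proof. by elim: K => //= K; rewrite flat_cons => ->. Qed.

Lemma flat_init x K : tape_eq
  (head None (map Some x) :: behead (map Some x)) (flat (x :: nseq K [::])).
Proof.
rewrite flat_cons flat_nseq -[None :: nseq K None]/(nseq K.+1 None) => i.
rewrite nth_cat nth_nseq if_same size_map.
case: x => [|a x] /=; first by case: i => [|[]].
case: i => //= i; rewrite ltnS; case: ltnP => // le.
by rewrite nth_default // size_map.
Qed.

Lemma takeSome_flat s ss : takeSome (flat (s :: ss)) = s.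
Proof. by rewrite flat_cons; elim: s => //= b s ->. Qed.

(** Converts powers of [size x + 1] into the shape [c * size x ^ d + c] of
    [poly_time_computable]. *)
Lemma succ_expn_le n d : n.+1 ^ d <= 2 ^ d * n ^ d + 2 ^ d.
Proof.
case: n => [|n]; first by rewrite exp1n (leq_trans _ (leq_addl _ _)) // expn_gt0.
rewrite -expnMn; apply: leq_trans (leq_addr _ _).
case: d => // d; rewrite leq_exp2r //; lia.
Qed.

Lemma poly_time_srun K (Q : finType) (prog : Q -> instr (option Q)) oq0 f a b :
  (forall q, instr_idx (prog q) < K.+1) ->
  (forall x, exists ss', srun prog (a * (size x).+1 ^ b.+1)
     (oq0, x :: nseq K [::]) = (None, f x :: ss')) ->
  poly_time_computable f.
Proof.
(* With [u = (size x).+1 ^ b.+1], there are [a * u] instructions on a tape of at most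
   [(K.+1 + a) * u] cells, hence at most [c * u ^ 2] steps, and [u ^ 2 = (size x).+1 ^ e]. *)
move=> wf H; set c := a * (3 * (K.+1 + a) + 3); set e := b.+1 + b.+1.
exists (mkTM (sim_home K.+1 prog oq0) (@sim_delta K.+1 Q prog)), (c * 2 ^ e), e.
move=> x; have [ss' E] := H x.
have sK : size (x :: nseq K [::]) = K.+1 by rewrite /= size_nseq.
have [n nle st] := sim_run wf sK E.
have := exec_tsteps (sim_home K.+1 prog oq0) (T := c * 2 ^ e * size x ^ e + c * 2 ^ e) st
  _ _ _.
rewrite /= takeSome_flat; apply=> //; last first.
  by split=> //=; exact: flat_init.
rewrite -mulnA -mulnDr; apply: leq_trans nle (leq_trans _ (leq_mul (leqnn c) (succ_expn_le _ _))).
have -> : size (flat (x :: nseq K [::])) = size x + K.+1.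
  by rewrite flat_cons size_cat /= size_map flat_nseq size_nseq.
rewrite /c /e expnD; set u := (size x).+1 ^ b.+1.
have u1 : size x < u by rewrite /u expnS leq_pmulr // expn_gt0.
rewrite -mulnA [X in _ <= X]mulnCA; apply: leq_trans (leqnn _) _.
nia.
Qed.

(** * Structured commands and their compilation to jumps *)

Record prog := Prog {
  pQ : finType;
  pstart : option pQ;
  pcode : pQ -> instr (option pQ)
}.

Definition imap T U (f : T -> U) (a : instr T) : instr U :=
  match a with
  | IPush i b t => IPush i b (f t)
  | IPop i te t1 t0 => IPop i (f te) (f t1) (f t0)
  end.

Lemma instr_idx_imap T U (f : T -> U) a : instr_idx (imap f a) = instr_idx a.
Proof. by case: a. Qed.

Lemma instr_step_imap T U (f : T -> U) a ss :
  instr_step (imap f a) ss = (f (instr_step a ss).1, (instr_step a ss).2).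
Proof. by case: a => //= i te t1 t0; case: nth => // -[]. Qed.

(** A program embedded in a larger one has its states renamed by [f] and its exit turned into a jump
    to [e]. *)
Definition lift_target (Q Q' : Type) (f : Q -> Q') (e : option Q')
    (o : option Q) : option Q' := if o is Some q then Some (f q) else e.

(** The time [t] is only an upper bound, a finished run being stationary; [t1] is the actual moment
    of exit, from which the host program continues. *)
Lemma srun_embed (Q Q' : Type) (p : Q -> instr (option Q))
    (p' : Q' -> instr (option Q')) (f : Q -> Q') (e : option Q') t o ss ss' :
  (forall q, p' (f q) = imap (lift_target f e) (p q)) ->
  srun p t (o, ss) = (None, ss') ->
  exists2 t1, t1 <= t &
    forall u, srun p' (t1 + u) (lift_target f e o, ss) = srun p' u (e, ss').
Proof.
move=> emb; elim: t o ss => [|t IH] [q|] ss //=.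
- by case=> <-; exists 0.
- case E: (instr_step _ _) => [o1 ss1] /IH [t1 le1 H].
  by exists t1.+1 => // u; rewrite addSn /= emb instr_step_imap E /= H.
- by case=> <-; exists 0.
Qed.

Lemma srun_None (Q : Type) (p : Q -> instr (option Q)) u ss :
  srun p u (None, ss) = (None, ss).
Proof. by case: u. Qed.

Lemma srun_leq (Q : Type) (p : Q -> instr (option Q)) t t' o ss ss' :
  t <= t' -> srun p t (o, ss) = (None, ss') -> srun p t' (o, ss) = (None, ss').
Proof.
elim: t t' o ss => [|t IH] t' [q|] ss //=; first by rewrite !srun_None.
- by case: t' => //= t' le; case: (instr_step _ _) => o1 ss1; apply: IH.
- by rewrite !srun_None.
Qed.

(* [Branch i cA A cB B] pops stack [i]: it exits if the stack was empty, otherwise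
   it runs [A] or [B] according to the symbol popped and then, if [cA] (resp.
   [cB]) holds, starts again. *)
Inductive cmd :=
| Nop
| Push of nat & bool
| Seq of cmd & cmd
| Branch of nat & bool & cmd & bool & cmd.

Definition seq_prog (A B : prog) : prog :=
  @Prog (pQ A + pQ B)%type
    (lift_target inl (omap inr (pstart B)) (pstart A))
    (fun q => match q with
      | inl q => imap (lift_target inl (omap inr (pstart B))) (pcode q)
      | inr q => imap (lift_target inr None) (pcode q)
      end).

(** [Some None] is the pop itself and [None] the exit; the flags decide to which of them a finished
    body returns. *)
Definition branch_prog i (cA : bool) (A : prog) (cB : bool) (B : prog) : prog :=
  let back (c : bool) : option (option (pQ A + pQ B)) := if c then Some None else None in
  let fA q := Some (inl q) in
  let fB q := Some (inr q) in
  @Prog (option (pQ A + pQ B))%type (Some None)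
    (fun q => match q with
      | None => IPop i None (lift_target fA (back cA) (pstart A))
                            (lift_target fB (back cB) (pstart B))
      | Some (inl q) => imap (lift_target fA (back cA)) (pcode q)
      | Some (inr q) => imap (lift_target fB (back cB)) (pcode q)
      end).

Fixpoint compile (c : cmd) : prog :=
  match c with
  | Nop => @Prog void None (fun q => match q with end)
  | Push i b => @Prog unit (Some tt) (fun _ => IPush i b None)
  | Seq A B => seq_prog (compile A) (compile B)
  | Branch i cA A cB B => branch_prog i cA (compile A) cB (compile B)
  end.

Fixpoint uses (K : nat) (c : cmd) : bool :=
  match c with
  | Nop => true
  | Push i _ => i < K
  | Seq A B => uses K A && uses K B
  | Branch i _ A _ B => [&& i < K, uses K A & uses K B]
  end.

Lemma uses_compile K c : uses K c ->
  forall q, instr_idx (pcode (p := compile c) q) < K.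
Proof.
elim: c => [|i b|A IHA B IHB|i cA A IHA cB B IHB] /=.
- by move=> _ [].
- by [].
- by case/andP=> /IHA a /IHB b [q|q]; rewrite instr_idx_imap.
- by case/and3P=> iK /IHA a /IHB b [[q|q]|]; rewrite ?instr_idx_imap.
Qed.

(* A [Variant] rather than a definition, so that unification never unfolds
   compiled programs. *)
Variant runs (c : cmd) (t : nat) (ss ss' : stacks) : Prop :=
  Runs of srun (pcode (p := compile c)) t (pstart (compile c), ss) = (None, ss').

Lemma runs_leq M t t' ss ss' : runs M t ss ss' -> t <= t' -> runs M t' ss ss'.
Proof. by case=> H le; split; apply: srun_leq H. Qed.

Lemma runs_nop ss : runs Nop 0 ss ss. Proof. by split. Qed.

Lemma runs_push i b ss : runs (Push i b) 1 ss (upd ss i (b :: nth [::] ss i)).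
Proof. by split. Qed.

Lemma runs_seq A B t u s1 s2 s3 :
  runs A t s1 s2 -> runs B u s2 s3 -> runs (Seq A B) (t + u) s1 s3.
Proof.
case=> HA [HB]; split.
have [t1 le1 EA] := @srun_embed _ _ _ (pcode (p := compile (Seq A B))) inl
  (omap inr (pstart (compile B))) _ _ _ _ (fun=> erefl) HA.
have [u1 le2 EB] := @srun_embed _ _ _ (pcode (p := compile (Seq A B))) inr
  None _ _ _ _ (fun=> erefl) HB.
apply: (@srun_leq _ _ (t1 + (u1 + 0))); first lia.
by rewrite EA -[omap _ _]/(lift_target inr None (pstart (compile B))) EB.
Qed.

Lemma runs_branch_nil i cA A cB B ss : nth [::] ss i = [::] ->
  runs (Branch i cA A cB B) 1 ss ss.
Proof. by move=> E; split; rewrite /= E. Qed.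

Lemma runs_branch_true i (cA : bool) A cB B t u s1 s2 s3 s :
  nth [::] s1 i = true :: s -> runs A t (upd s1 i s) s2 ->
  (if cA then runs (Branch i cA A cB B) u s2 s3 else s2 = s3) ->
  runs (Branch i cA A cB B) (1 + t + u) s1 s3.
Proof.
move=> E [HA] HB; split; set M := compile _.
have [t1 le1 EA] := @srun_embed _ _ _ (pcode (p := M)) (fun q => Some (inl q))
  (if cA then Some None else None) _ _ _ _ (fun=> erefl) HA.
apply: (@srun_leq _ _ (1 + (t1 + u))); first by rewrite addnA leq_add2r ltnS.
by rewrite /= E EA; case: cA @M {EA} HB => [M [] //|M ->]; exact: srun_None.
Qed.

Lemma runs_branch_false i cA A (cB : bool) B t u s1 s2 s3 s :
  nth [::] s1 i = false :: s -> runs B t (upd s1 i s) s2 ->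
  (if cB then runs (Branch i cA A cB B) u s2 s3 else s2 = s3) ->
  runs (Branch i cA A cB B) (1 + t + u) s1 s3.
Proof.
move=> E [HA] HB; split; set M := compile _.
have [t1 le1 EA] := @srun_embed _ _ _ (pcode (p := M)) (fun q => Some (inr q))
  (if cB then Some None else None) _ _ _ _ (fun=> erefl) HA.
apply: (@srun_leq _ _ (1 + (t1 + u))); first by rewrite addnA leq_add2r ltnS.
by rewrite /= E EA; case: cB @M {EA} HB => [M [] //|M ->]; exact: srun_None.
Qed.

(** * The program computing the reduction *)


(* Reading past the end of the input yields the number 0. *)
Fixpoint num (s : seq bool) : nat := if s is true :: s' then (num s').+1 else 0.

Fixpoint rest (s : seq bool) : seq bool :=
  match s with true :: s' => rest s' | false :: s' => s' | [::] => [::] end.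

Notation ones k s := (ncons k true s).

Lemma size_rest s : size (rest s) <= size s.
Proof. by elim: s => //= -[] s IH //=; apply: leqW. Qed.

Lemma num_le_size s : num s <= size s.
Proof. by elim: s => //= -[]. Qed.

Lemma num_ones k : num (ones k [::]) = k.
Proof. by elim: k => //= k ->. Qed.

Lemma rest_ones k : rest (ones k [::]) = [::].
Proof. by elim: k. Qed.

Notation "A ;; B" := (Seq A B) (at level 60, right associativity).

(** Stopping at a terminator as well as at the bottom of the stack lets the same loop serve the
    encoded numbers of the input and the bare unary counters. *)
Definition for1 (i : nat) (A : cmd) : cmd := Branch i true A false Nop.

(** [f j] describes the other stacks after [j] rounds. Its component [i] is overwritten by [upd], so
    its value there is arbitrary; the body must work for any remainder [s'] of the number driving
    the loop. *)
Lemma runs_for1 i A c (f : nat -> stacks) s :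
  (forall j, i < size (f j)) ->
  (forall j s', j < num s -> runs A c (upd (f j) i s') (upd (f j.+1) i s')) ->
  runs (for1 i A) (num s * c.+1 + 1) (upd (f 0) i s) (upd (f (num s)) i (rest s)).
Proof.
elim: s f => [|b s IH] f fi.
  move=> _; apply: runs_branch_nil.
  by rewrite /upd nth_cat size_takel ?(ltnW (fi _)) // ltnn subnn.
have nthu s' : nth [::] (upd (f 0) i s') i = s'.
  by rewrite /upd nth_cat size_takel ?(ltnW (fi _)) // ltnn subnn.
have updu s' s'' : upd (upd (f 0) i s') i s'' = upd (f 0) i s''.
  rewrite /upd take_size_cat ?size_takel ?(ltnW (fi _)) // drop_cat size_takel ?(ltnW (fi _)) //.
  by rewrite ltnNge leqnSn /= subSnn /= drop0.
case: b => /= H.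
  have -> : (num s).+1 * c.+1 + 1 = 1 + c + (num s * c.+1 + 1) by lia.
  apply: runs_branch_true; first exact: nthu.
    by rewrite updu; apply: H.
  by apply: (IH (fun j => f j.+1)) => // j s' lt; apply: H.
rewrite mul0n -[0 + 1]/(1 + 0 + 0); apply: runs_branch_false; first exact: nthu.
  by rewrite updu; apply: runs_nop.
by [].
Qed.

Definition rd i j := for1 i (Push j true).

(** Reading a counter destroys it, so it travels to the scratch stack 3, expected empty, and is
    restored while the copy is emitted. *)
Definition copy i j := rd i 3 ;; for1 3 (Push i true ;; Push j true).

(** The new vertex is named by the current number of vertices, held on stack 1, which is then
    incremented. *)
Definition add_pendant :=
  Push 4 false ;; copy 1 4 ;; Push 4 false ;; Push 1 true.

(** The head of the arc is the current number of edges, that is, the index of the pendant edge about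
    to be added. *)
Definition add_arc := rd 0 5 ;; Push 5 false ;; copy 2 5 ;; Push 5 false.

Definition unload i := Branch i true (Push 0 true) true (Push 0 false).

(* Stacks: 0 the input and finally the output; 1 and 2 the current numbers of
   vertices and edges, in unary; 3 scratch; 4 and 5 the edges and arcs written so
   far, reversed; 6 and 7 the number of pairs of [D] to read and read; 8 the number
   of edges with lower bound 0. *)
Definition reduction_prog : cmd :=
  ((Branch 0 false (rd 0 1) false Nop ;; Push 1 true) ;;
   for1 0 (Push 2 true ;; Push 3 true) ;;
   for1 3 (rd 0 4 ;; Push 4 false ;; rd 0 4 ;; Push 4 false) ;;
   add_pendant ;; add_pendant ;;
   rd 0 6 ;; Push 6 true) ;;
  (Push 0 false ;; copy 2 0 ;; Push 0 true ;; Push 0 false ;; copy 2 0 ;;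
   Push 2 true ;; Push 2 true ;; copy 2 8) ;;
  for1 6 (Push 7 true ;; add_arc ;; add_arc ;; Push 2 true ;; add_pendant) ;;
  (for1 2 (Push 3 true ;; Push 0 false ;; Push 0 true ;; Push 0 true) ;;
   for1 7 (Push 6 true ;; Push 0 false ;; Push 0 true) ;;
   for1 8 (Push 0 false) ;;
   unload 5 ;;
   Push 0 false ;; for1 6 (Push 0 true ;; Push 0 true) ;;
   unload 4 ;;
   Push 0 false ;; rd 3 0 ;; Push 0 false ;; rd 1 0).

Lemma uses_reduction_prog : uses 9 reduction_prog.
Proof. by []. Qed.

(** * Effect and cost of the loops *)

Ltac run_with tac :=
  lazymatch goal with
  | |- runs (Seq _ _) _ _ _ => apply: runs_seq; [run_with tac | run_with tac]
  | |- runs (Push _ _) _ _ _ => exact: runs_push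
  | |- _ => cbn [upd take drop cat nth]; tac
  end.

Ltac run_pushes := apply: runs_leq; [run_with idtac | by []].

Lemma runs_rd01 s0 s1 s2 s3 s4 s5 s6 s7 s8 :
  runs (rd 0 1) (num s0 * 2 + 1) [:: s0; s1; s2; s3; s4; s5; s6; s7; s8]
    [:: rest s0; ones (num s0) s1; s2; s3; s4; s5; s6; s7; s8].
Proof.
by apply: (@runs_for1 0 _ 1 (fun j =>
  [:: [::]; ones j s1; s2; s3; s4; s5; s6; s7; s8])) => // j s' _; run_pushes.
Qed.

Lemma runs_rd04 s0 s1 s2 s3 s4 s5 s6 s7 s8 :
  runs (rd 0 4) (num s0 * 2 + 1) [:: s0; s1; s2; s3; s4; s5; s6; s7; s8]
    [:: rest s0; s1; s2; s3; ones (num s0) s4; s5; s6; s7; s8].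
Proof.
by apply: (@runs_for1 0 _ 1 (fun j =>
  [:: [::]; s1; s2; s3; ones j s4; s5; s6; s7; s8])) => // j s' _; run_pushes.
Qed.

Lemma runs_rd05 s0 s1 s2 s3 s4 s5 s6 s7 s8 :
  runs (rd 0 5) (num s0 * 2 + 1) [:: s0; s1; s2; s3; s4; s5; s6; s7; s8]
    [:: rest s0; s1; s2; s3; s4; ones (num s0) s5; s6; s7; s8].
Proof.
by apply: (@runs_for1 0 _ 1 (fun j =>
  [:: [::]; s1; s2; s3; s4; ones j s5; s6; s7; s8])) => // j s' _; run_pushes.
Qed.

Lemma runs_rd06 s0 s1 s2 s3 s4 s5 s6 s7 s8 :
  runs (rd 0 6) (num s0 * 2 + 1) [:: s0; s1; s2; s3; s4; s5; s6; s7; s8]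
    [:: rest s0; s1; s2; s3; s4; s5; ones (num s0) s6; s7; s8].
Proof.
by apply: (@runs_for1 0 _ 1 (fun j =>
  [:: [::]; s1; s2; s3; s4; s5; ones j s6; s7; s8])) => // j s' _; run_pushes.
Qed.

Lemma runs_rd13 s0 s1 s2 s3 s4 s5 s6 s7 s8 :
  runs (rd 1 3) (num s1 * 2 + 1) [:: s0; s1; s2; s3; s4; s5; s6; s7; s8]
    [:: s0; rest s1; s2; ones (num s1) s3; s4; s5; s6; s7; s8].
Proof.
by apply: (@runs_for1 1 _ 1 (fun j =>
  [:: s0; [::]; s2; ones j s3; s4; s5; s6; s7; s8])) => // j s' _; run_pushes.
Qed.

Lemma runs_rd23 s0 s1 s2 s3 s4 s5 s6 s7 s8 :
  runs (rd 2 3) (num s2 * 2 + 1) [:: s0; s1; s2; s3; s4; s5; s6; s7; s8]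
    [:: s0; s1; rest s2; ones (num s2) s3; s4; s5; s6; s7; s8].
Proof.
by apply: (@runs_for1 2 _ 1 (fun j =>
  [:: s0; s1; [::]; ones j s3; s4; s5; s6; s7; s8])) => // j s' _; run_pushes.
Qed.

Lemma runs_rd30 s0 s1 s2 s3 s4 s5 s6 s7 s8 :
  runs (rd 3 0) (num s3 * 2 + 1) [:: s0; s1; s2; s3; s4; s5; s6; s7; s8]
    [:: ones (num s3) s0; s1; s2; rest s3; s4; s5; s6; s7; s8].
Proof.
by apply: (@runs_for1 3 _ 1 (fun j =>
  [:: ones j s0; s1; s2; [::]; s4; s5; s6; s7; s8])) => // j s' _; run_pushes.
Qed.

Lemma runs_rd10 s0 s1 s2 s3 s4 s5 s6 s7 s8 :
  runs (rd 1 0) (num s1 * 2 + 1) [:: s0; s1; s2; s3; s4; s5; s6; s7; s8]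
    [:: ones (num s1) s0; rest s1; s2; s3; s4; s5; s6; s7; s8].
Proof.
by apply: (@runs_for1 1 _ 1 (fun j =>
  [:: ones j s0; [::]; s2; s3; s4; s5; s6; s7; s8])) => // j s' _; run_pushes.
Qed.

Lemma runs_dup14 s0 s1 s2 s3 s4 s5 s6 s7 s8 :
  runs (for1 3 (Push 1 true ;; Push 4 true)) (num s3 * 3 + 1) [:: s0; s1; s2; s3; s4; s5; s6; s7; s8]
    [:: s0; ones (num s3) s1; s2; rest s3; ones (num s3) s4; s5; s6; s7; s8].
Proof.
by apply: (@runs_for1 3 _ 2 (fun j =>
  [:: s0; ones j s1; s2; [::]; ones j s4; s5; s6; s7; s8])) => // j s' _; run_pushes.
Qed.

Lemma runs_copy14 k s0 s2 s4 s5 s6 s7 s8 :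
  runs (copy 1 4) (5 * k + 2) [:: s0; ones k [::]; s2; [::]; s4; s5; s6; s7; s8]
    [:: s0; ones k [::]; s2; [::]; ones k s4; s5; s6; s7; s8].
Proof.
have := runs_dup14 s0 [::] s2 (ones k [::]) s4 s5 s6 s7 s8.
rewrite num_ones rest_ones => H; apply: runs_leq.
  by apply: runs_seq; first exact: runs_rd13; rewrite num_ones rest_ones; exact: H.
rewrite num_ones; lia.
Qed.

Lemma runs_dup25 s0 s1 s2 s3 s4 s5 s6 s7 s8 :
  runs (for1 3 (Push 2 true ;; Push 5 true)) (num s3 * 3 + 1) [:: s0; s1; s2; s3; s4; s5; s6; s7; s8]
    [:: s0; s1; ones (num s3) s2; rest s3; s4; ones (num s3) s5; s6; s7; s8].
Proof.
by apply: (@runs_for1 3 _ 2 (fun j =>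
  [:: s0; s1; ones j s2; [::]; s4; ones j s5; s6; s7; s8])) => // j s' _; run_pushes.
Qed.

Lemma runs_copy25 k s0 s1 s4 s5 s6 s7 s8 :
  runs (copy 2 5) (5 * k + 2) [:: s0; s1; ones k [::]; [::]; s4; s5; s6; s7; s8]
    [:: s0; s1; ones k [::]; [::]; s4; ones k s5; s6; s7; s8].
Proof.
have := runs_dup25 s0 s1 [::] (ones k [::]) s4 s5 s6 s7 s8.
rewrite num_ones rest_ones => H; apply: runs_leq.
  by apply: runs_seq; first exact: runs_rd23; rewrite num_ones rest_ones; exact: H.
rewrite num_ones; lia.
Qed.

Lemma runs_dup20 s0 s1 s2 s3 s4 s5 s6 s7 s8 :
  runs (for1 3 (Push 2 true ;; Push 0 true)) (num s3 * 3 + 1) [:: s0; s1; s2; s3; s4; s5; s6; s7; s8]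
    [:: ones (num s3) s0; s1; ones (num s3) s2; rest s3; s4; s5; s6; s7; s8].
Proof.
by apply: (@runs_for1 3 _ 2 (fun j =>
  [:: ones j s0; s1; ones j s2; [::]; s4; s5; s6; s7; s8])) => // j s' _; run_pushes.
Qed.

Lemma runs_copy20 k s0 s1 s4 s5 s6 s7 s8 :
  runs (copy 2 0) (5 * k + 2) [:: s0; s1; ones k [::]; [::]; s4; s5; s6; s7; s8]
    [:: ones k s0; s1; ones k [::]; [::]; s4; s5; s6; s7; s8].
Proof.
have := runs_dup20 s0 s1 [::] (ones k [::]) s4 s5 s6 s7 s8.
rewrite num_ones rest_ones => H; apply: runs_leq.
  by apply: runs_seq; first exact: runs_rd23; rewrite num_ones rest_ones; exact: H.
rewrite num_ones; lia.
Qed.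

Lemma runs_dup28 s0 s1 s2 s3 s4 s5 s6 s7 s8 :
  runs (for1 3 (Push 2 true ;; Push 8 true)) (num s3 * 3 + 1) [:: s0; s1; s2; s3; s4; s5; s6; s7; s8]
    [:: s0; s1; ones (num s3) s2; rest s3; s4; s5; s6; s7; ones (num s3) s8].
Proof.
by apply: (@runs_for1 3 _ 2 (fun j =>
  [:: s0; s1; ones j s2; [::]; s4; s5; s6; s7; ones j s8])) => // j s' _; run_pushes.
Qed.

Lemma runs_copy28 k s0 s1 s4 s5 s6 s7 s8 :
  runs (copy 2 8) (5 * k + 2) [:: s0; s1; ones k [::]; [::]; s4; s5; s6; s7; s8]
    [:: s0; s1; ones k [::]; [::]; s4; s5; s6; s7; ones k s8].
Proof.
have := runs_dup28 s0 s1 [::] (ones k [::]) s4 s5 s6 s7 s8.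
rewrite num_ones rest_ones => H; apply: runs_leq.
  by apply: runs_seq; first exact: runs_rd23; rewrite num_ones rest_ones; exact: H.
rewrite num_ones; lia.
Qed.

Lemma runs_read_m s0 s1 s2 s3 s4 s5 s6 s7 s8 :
  runs (for1 0 (Push 2 true ;; Push 3 true)) (num s0 * 3 + 1) [:: s0; s1; s2; s3; s4; s5; s6; s7; s8]
    [:: rest s0; s1; ones (num s0) s2; ones (num s0) s3; s4; s5; s6; s7; s8].
Proof.
by apply: (@runs_for1 0 _ 2 (fun j =>
  [:: [::]; s1; ones j s2; ones j s3; s4; s5; s6; s7; s8])) => // j s' _; run_pushes.
Qed.

(** The loop uses up the number of edges, still needed for the header, and therefore rebuilds it on
    stack 3. *)
Lemma runs_upper s0 s1 s2 s3 s4 s5 s6 s7 s8 :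
  runs (for1 2 (Push 3 true ;; Push 0 false ;; Push 0 true ;; Push 0 true)) (num s2 * 5 + 1) [:: s0; s1; s2; s3; s4; s5; s6; s7; s8]
    [:: iter (num s2) (cat [:: true; true; false]) s0; s1; rest s2; ones (num s2) s3; s4; s5; s6; s7; s8].
Proof.
by apply: (@runs_for1 2 _ 4 (fun j =>
  [:: iter j (cat [:: true; true; false]) s0; s1; [::]; ones j s3; s4; s5; s6; s7; s8])) => // j s' _; run_pushes.
Qed.

Lemma runs_lower1 s0 s1 s2 s3 s4 s5 s6 s7 s8 :
  runs (for1 7 (Push 6 true ;; Push 0 false ;; Push 0 true)) (num s7 * 4 + 1) [:: s0; s1; s2; s3; s4; s5; s6; s7; s8]
    [:: iter (num s7) (cat [:: true; false]) s0; s1; s2; s3; s4; s5; ones (num s7) s6; rest s7; s8].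
Proof.
by apply: (@runs_for1 7 _ 3 (fun j =>
  [:: iter j (cat [:: true; false]) s0; s1; s2; s3; s4; s5; ones j s6; [::]; s8])) => // j s' _; run_pushes.
Qed.

Lemma runs_lower0 s0 s1 s2 s3 s4 s5 s6 s7 s8 :
  runs (for1 8 (Push 0 false)) (num s8 * 2 + 1) [:: s0; s1; s2; s3; s4; s5; s6; s7; s8]
    [:: ncons (num s8) false s0; s1; s2; s3; s4; s5; s6; s7; rest s8].
Proof.
by apply: (@runs_for1 8 _ 1 (fun j =>
  [:: ncons j false s0; s1; s2; s3; s4; s5; s6; s7; [::]])) => // j s' _; run_pushes.
Qed.

Lemma runs_double s0 s1 s2 s3 s4 s5 s6 s7 s8 :
  runs (for1 6 (Push 0 true ;; Push 0 true)) (num s6 * 3 + 1) [:: s0; s1; s2; s3; s4; s5; s6; s7; s8]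
    [:: iter (num s6) (cat [:: true; true]) s0; s1; s2; s3; s4; s5; rest s6; s7; s8].
Proof.
by apply: (@runs_for1 6 _ 2 (fun j =>
  [:: iter j (cat [:: true; true]) s0; s1; s2; s3; s4; s5; [::]; s7; s8])) => // j s' _; run_pushes.
Qed.

Lemma runs_unload4 s0 s1 s2 s3 s4 s5 s6 s7 s8 :
  runs (unload 4) (2 * size s4 + 1) [:: s0; s1; s2; s3; s4; s5; s6; s7; s8]
    [:: catrev s4 s0; s1; s2; s3; [::]; s5; s6; s7; s8].
Proof.
elim: s4 s0 => [|b s IH] s0; first exact: runs_branch_nil.
have -> : 2 * size (b :: s) + 1 = 1 + 1 + (2 * size s + 1) by rewrite /=; lia.
case: b.
- by apply: runs_branch_true; [| apply: runs_push | apply: IH].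
- by apply: runs_branch_false; [| apply: runs_push | apply: IH].
Qed.

Lemma runs_unload5 s0 s1 s2 s3 s4 s5 s6 s7 s8 :
  runs (unload 5) (2 * size s5 + 1) [:: s0; s1; s2; s3; s4; s5; s6; s7; s8]
    [:: catrev s5 s0; s1; s2; s3; s4; [::]; s6; s7; s8].
Proof.
elim: s5 s0 => [|b s IH] s0; first exact: runs_branch_nil.
have -> : 2 * size (b :: s) + 1 = 1 + 1 + (2 * size s + 1) by rewrite /=; lia.
case: b.
- by apply: runs_branch_true; [| apply: runs_push | apply: IH].
- by apply: runs_branch_false; [| apply: runs_push | apply: IH].
Qed.

Lemma runs_add_pendant n s0 s2 s4 s5 s6 s7 s8 :
  runs add_pendant (5 * n + 5) [:: s0; ones n [::]; s2; [::]; s4; s5; s6; s7; s8]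
    [:: s0; ones n.+1 [::]; s2; [::]; false :: ones n (false :: s4); s5; s6; s7; s8].
Proof.
rewrite /add_pendant; apply: runs_leq; first by run_with ltac:(exact: runs_copy14).
lia.
Qed.

Lemma runs_add_arc m s0 s1 s4 s5 s6 s7 s8 :
  runs add_arc (2 * num s0 + 5 * m + 5)
    [:: s0; s1; ones m [::]; [::]; s4; s5; s6; s7; s8]
    [:: rest s0; s1; ones m [::]; [::]; s4;
        false :: ones m (false :: ones (num s0) s5); s6; s7; s8].
Proof.
rewrite /add_arc; apply: runs_leq.
  run_with ltac:(first [exact: runs_rd05 | exact: runs_copy25]).
lia.
Qed.

(** The state consists of the remaining input and the list written so far, reversed. *)
Definition read_pair (p : seq bool * seq bool) :=
  (rest (rest p.1), false :: ones (num (rest p.1)) (false :: ones (num p.1) p.2)).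

Lemma size_read_pairs j p : size (iter j read_pair p).1 <= size p.1.
Proof.
elim: j => //= j; apply: leq_trans.
exact: leq_trans (size_rest _) (size_rest _).
Qed.

Lemma runs_read_pairs m s0 s1 s2 s4 s5 s6 s7 s8 :
  let p := iter m read_pair (s0, s4) in
  runs (for1 3 (rd 0 4 ;; Push 4 false ;; rd 0 4 ;; Push 4 false))
    (m * (4 * size s0 + 5) + 1)
    [:: s0; s1; s2; ones m [::]; s4; s5; s6; s7; s8]
    [:: p.1; s1; s2; [::]; p.2; s5; s6; s7; s8].
Proof.
have := @runs_for1 3 (rd 0 4 ;; Push 4 false ;; rd 0 4 ;; Push 4 false)
  (4 * size s0 + 4) (fun j => let p := iter j read_pair (s0, s4) in
    [:: p.1; s1; s2; [::]; p.2; s5; s6; s7; s8]) (ones m [::]).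
rewrite num_ones rest_ones -addnS; apply=> // j s' _.
apply: runs_leq; first by run_with ltac:(exact: runs_rd04).
have := size_read_pairs j (s0, s4); set p := iter _ _ _ => /= H.
have := num_le_size p.1; have := num_le_size (rest p.1); have := size_rest p.1.
lia.
Qed.

(** Round [i] creates the edge of index [i + m], so both arcs written in it enter that edge. *)
Definition arc_step m i (p : seq bool * seq bool) :=
  (rest (rest p.1),
   false :: ones (i + m) (false :: ones (num (rest p.1))
     (false :: ones (i + m) (false :: ones (num p.1) p.2)))).

Definition pendant_step n i (e : seq bool) := false :: ones (i + n) (false :: e).

Lemma size_arc_steps m j p : size (iteri j (arc_step m) p).1 <= size p.1.
Proof.
elim: j => //= j; apply: leq_trans.
exact: leq_trans (size_rest _) (size_rest _).
Qed.

Lemma runs_add_pairs n m d s0 s4 s5 s7 s8 :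
  let p := iteri d (arc_step m) (s0, s5) in
  runs (for1 6 (Push 7 true ;; add_arc ;; add_arc ;; Push 2 true ;; add_pendant))
    (d * (4 * size s0 + 15 * (d + m + n) + 20) + 1)
    [:: s0; ones n [::]; ones m [::]; [::]; s4; s5; ones d [::]; s7; s8]
    [:: p.1; ones (d + n) [::]; ones (d + m) [::]; [::];
        iteri d (pendant_step n) s4; p.2; [::]; ones d s7; s8].
Proof.
have := @runs_for1 6
  (Push 7 true ;; add_arc ;; add_arc ;; Push 2 true ;; add_pendant)
  (4 * size s0 + 15 * (d + m + n) + 19)
  (fun j => let p := iteri j (arc_step m) (s0, s5) in
    [:: p.1; ones (j + n) [::]; ones (j + m) [::]; [::];
        iteri j (pendant_step n) s4; p.2; [::]; ones j s7; s8]) (ones d [::]).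
rewrite num_ones rest_ones -addnS; apply=> // j s' jd.
apply: runs_leq.
  run_with ltac:(first [exact: runs_add_arc | exact: runs_add_pendant]).
have := size_arc_steps m j (s0, s5); set p := iteri _ _ _ => /= H.
have := num_le_size p.1; have := num_le_size (rest p.1); have := size_rest p.1.
lia.
Qed.

(** * The computed function and its running time *)

Definition reduction (x : seq bool) : seq bool :=
  let n := (num x).-1.+1 in
  let m := num (rest x) in
  let p := iter m read_pair (rest (rest x), [::]) in
  let d := (num p.1).+1 in
  (* The pair [(m, m.+1)] is pushed in front of the unread pairs; the successor in [d] accounts for
     it. *)
  let s := ones m (false :: ones m.+1 (false :: rest p.1)) in
  let q := iteri d (arc_step m.+2) (s, [::]) in
  let e := iteri d (pendant_step n.+2) (pendant_step n 1 (pendant_step n 0 p.2)) in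
  ones (d + n.+2) (false :: ones (d + m.+2) (false ::
    catrev e (iter d (cat [:: true; true]) (false ::
      catrev q.2 (ncons m.+2 false (iter d (cat [:: true; false])
        (iter (d + m.+2) (cat [:: true; true; false]) q.1))))))).

Lemma size_iter_read_pair j p :
  size (iter j read_pair p).2 <= size p.2 + j * (2 * size p.1 + 2).
Proof.
elim: j => [|j IH] /=; first by rewrite addn0.
have := size_read_pairs j p; move: IH; set q := iter _ _ _.
have := num_le_size q.1; have := num_le_size (rest q.1); have := size_rest q.1.
rewrite size_ncons /= size_ncons mulSn; lia.
Qed.

Lemma size_iteri_arc_step m j p :
  size (iteri j (arc_step m) p).2 <= size p.2 + j * (2 * size p.1 + 2 * (j + m) + 4).
Proof.
elim: j => [|j IH] /=; first by rewrite addn0.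
have := size_arc_steps m j p; move: IH; set q := iteri _ _ _.
have := num_le_size q.1; have := num_le_size (rest q.1); have := size_rest q.1.
do ![rewrite size_ncons /=]; rewrite mulSn.
have : j * (2 * size p.1 + 2 * (j + m) + 4) <= j * (2 * size p.1 + 2 * (j.+1 + m) + 4).
  by rewrite leq_mul2l; apply/orP; right; lia.
lia.
Qed.

Lemma size_iteri_pendant_step n j e :
  size (iteri j (pendant_step n) e) <= size e + j * (j + n + 2).
Proof.
elim: j => [|j IH] /=; first by rewrite addn0.
rewrite size_ncons /=; nia.
Qed.

Lemma runs_eq c t ss s1 s2 : runs c t ss s1 -> s1 = s2 -> runs c t ss s2.
Proof. by move=> H <-. Qed.

(** Popping one symbol before the transfer and pushing one afterwards replaces a vertex number 0 by
    1 and keeps every other one. *)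
Lemma runs_init x :
  runs (Branch 0 false (rd 0 1) false Nop ;; Push 1 true) (2 * size x + 4)
    (x :: nseq 8 [::])
    [:: rest x; ones (num x).-1.+1 [::]; [::]; [::]; [::]; [::]; [::]; [::]; [::]].
Proof.
apply: runs_leq.
  apply: (@runs_seq _ _ (2 * size x + 3) 1 _
    (rest x :: ones (num x).-1 [::] :: nseq 7 [::])); last exact: runs_push.
  case: x => [|[] x].
  - by apply: runs_leq; first exact: runs_branch_nil.
  - apply: runs_leq; first by apply: (@runs_branch_true 0 false _ _ _ _ 0 _ _ _ x); last by []; [|exact: runs_rd01].
    have /= := num_le_size x; rewrite -[X in 1 + X]/(num x * 2 + 1); lia.
  - apply: runs_leq; first by apply: (@runs_branch_false 0 _ _ false _ _ 0 _ _ _ x); last by []; [|exact: runs_nop].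
    lia.
lia.
Qed.

(** The numbers read are at most [size x]. Counting loops make linearly many rounds of at most
    linear cost, and the two unloaded lists have at most quadratic length; 1000 is a generous
    constant. *)
Lemma runs_reduction x : exists ss',
  runs reduction_prog (1000 * (size x).+1 ^ 2) (x :: nseq 8 [::])
    (reduction x :: ss').
Proof.
rewrite /reduction; set n := (num x).-1.+1; set m := num (rest x).
set p := iter _ _ _; set d := (num p.1).+1; set s := ones m (false :: _).
set e := iteri d (pendant_step _) _; set q := iteri d (arc_step _) _.
eexists; apply: runs_leq.
  rewrite /reduction_prog; apply: runs_seq.
    apply: runs_seq; first exact: runs_init.
    apply: runs_seq; first exact: runs_read_m.
    apply: runs_seq; first exact: runs_read_pairs.
    apply: runs_seq; first exact: runs_add_pendant.
    apply: runs_seq; first exact: runs_add_pendant.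
    apply: runs_seq; first exact: runs_rd06.
    exact: runs_push.
  apply: runs_seq.
    apply: runs_seq; first exact: runs_push.
    apply: runs_seq; first exact: runs_copy20.
    apply: runs_seq; first exact: runs_push.
    apply: runs_seq; first exact: runs_push.
    apply: runs_seq; first exact: runs_copy20.
    apply: runs_seq; first exact: runs_push.
    apply: runs_seq; first exact: runs_push.
    rewrite -/m -/p; cbn [upd take drop cat nth].
    rewrite -[true :: true :: _]/(ones m.+2 [::]); exact: runs_copy28.
  apply: runs_seq.
    rewrite -[true :: ones (num p.1) _]/(ones d [::]); exact: runs_add_pairs.
  rewrite -/s -/q -/e.
  apply: runs_seq; first exact: runs_upper.
  apply: runs_seq; first exact: runs_lower1.
  apply: runs_seq; first exact: runs_lower0.
  apply: runs_seq; first exact: runs_unload5.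
  apply: runs_seq; first exact: runs_push.
  apply: runs_seq; first exact: runs_double.
  apply: runs_seq; first exact: runs_unload4.
  apply: runs_seq; first exact: runs_push.
  apply: runs_seq; first exact: runs_rd30.
  apply: runs_seq; first exact: runs_push.
  rewrite ?num_ones ?rest_ones.
  by apply: runs_eq; [exact: runs_rd10 | rewrite num_ones rest_ones].
rewrite !num_ones -/n -/m -/p -/d -/s.
have nle : n <= (size x).+1 by have := num_le_size x; rewrite /n; lia.
have r1 := size_rest x; have r2 := size_rest (rest x).
have mle : m <= size x by apply: leq_trans (num_le_size _) r1.
have p1 : size p.1 <= size x.
  by apply: leq_trans (size_read_pairs _ _) _; apply: leq_trans r2 r1.
have dle : d <= (size x).+1 by rewrite ltnS; apply: leq_trans (num_le_size _) p1.
have sle : size s <= 3 * (size x).+1.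
  have := size_rest p.1; rewrite /s size_ncons /= size_ncons /=; lia.
have p2 : size p.2 <= m * (2 * size x + 2).
  apply: leq_trans (size_iter_read_pair _ _) _; rewrite add0n leq_mul2l.
  by apply/orP; right; rewrite /=; lia.
have ele : size e <= size p.2 + 2 * n + 5 + d * (d + n.+2 + 2).
  apply: leq_trans (size_iteri_pendant_step _ _ _) _.
  rewrite leq_add2r /= size_ncons /= size_ncons /=; rewrite /n; move: (size p.2) (num x).-1 => *; lia.
have qle : size q.2 <= d * (2 * size s + 2 * (d + m.+2) + 4) :=
  size_iteri_arc_step m.+2 d (s, [::]).
rewrite -[num p.1]/d.-1; clearbody q e s d p m n.
move: (size s) (size e) (size q.2) (size p.2) (size p.1) (size (rest (rest x)))
  (size (rest x)) (size x) r1 r2 mle p1 dle sle p2 ele qle nle.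
clear=> S E Q P2 P1 R2 R1 X r1 r2 mle p1 dle sle p2 ele qle nle.
(* Each product of two different quantities is bounded by a polynomial in [X] alone, so that the
   final comparison is between quadratic polynomials in [X]. *)
have p2' : P2 <= X.+1 * (2 * X + 2).
  by apply: leq_trans p2 _; apply: leq_mul => //; apply: leqW.
have ele' : E <= P2 + 2 * n + 5 + X.+1 * (X.+1 + X.+3 + 2).
  by apply: leq_trans ele _; rewrite leq_add2l; apply: leq_mul => //; lia.
have qle' : Q <= X.+1 * (2 * (3 * X.+1) + 2 * (X.+1 + X.+2) + 4).
  by apply: leq_trans qle _; apply: leq_mul => //; lia.
have l1 : m * (4 * R2 + 5) <= X.+1 * (4 * X + 5) by apply: leq_mul => //; lia.
have l2 : d * (4 * S + 15 * (d + m.+2 + n.+2) + 20) <=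
          X.+1 * (12 * X.+1 + 15 * (X.+1 + X.+2 + X.+3) + 20).
  by apply: leq_mul => //; lia.
set D := d * _ in l2 *; set M := m * _ in l1 *; clearbody D M.
clear p2 ele qle.
lia.
Qed.

(** * Spanning trees and pendant edges *)


Definition edges_below n (E : seq (nat * nat)) :=
  all (fun p => (p.1 < n) && (p.2 < n)) E.

(** With natural numbers as vertices, the relations before and after adding a vertex can be compared
    although their ordinal types differ. *)
Definition nadj (E : seq (nat * nat)) (m : bitseq) (u v : nat) : bool :=
  has (fun i => nth false m i && joins E i u v) (iota 0 (size E)).

Lemma nadj_rcons E m e b u v : size m = size E ->
  nadj (rcons E e) (rcons m b) u v =
  nadj E m u v || b && joins [:: e] 0 u v.
Proof.
move=> sm; rewrite /nadj size_rcons -addn1 iotaD has_cat /= orbF.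
congr (_ || _); last by rewrite /joins !nth_rcons sm ltnn eqxx.
apply: eq_in_has => i; rewrite mem_iota /= => ltiE.
by rewrite /joins !nth_rcons sm ltiE.
Qed.

Lemma nadj_below n E m u v : edges_below n E -> nadj E m u v -> (u < n) && (v < n).
Proof.
move=> /all_nthP below /hasP[i]; rewrite mem_iota /= => ltiE.
move=> /andP[_ /orP[]] /andP[/eqP<- /eqP<-]; first exact: below.
by rewrite andbC; apply: below.
Qed.

Lemma connect_homo (T U : finType) (e : rel T) (e' : rel U) (f : T -> U) :
  (forall x y, e x y -> connect e' (f x) (f y)) ->
  forall x y, connect e x y -> connect e' (f x) (f y).
Proof.
move=> H x _ /connectP[p ep ->]; elim: p x ep => //= y p IH x /andP[exy /IH].
by apply: connect_trans; apply: H.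
Qed.

(* A pendant vertex has a single neighbour, so it lies on no cycle, and
   contracting it onto that neighbour preserves connectivity. *)
Lemma spanning_tree_pendant n E m b :
  0 < n -> edges_below n E -> size m = size E ->
  spanning_tree n.+1 (rcons E (0, n)) (rcons m b) <-> b /\ spanning_tree n E m.
Proof.
case: n => // n _ below sm.
pose A' := @adj n.+2 (rcons E (0, n.+1)) (rcons m b); pose A := @adj n.+1 E m.
have A'E u v : A' u v =
    nadj E m u v || b && joins [:: (0, n.+1)] 0 u v by exact: nadj_rcons.
pose e (u : 'I_n.+1) : 'I_n.+2 := widen_ord (leqnSn _) u.
pose r (u : 'I_n.+2) : 'I_n.+1 := if u < n.+1 then inord u else ord0.
have er (u : 'I_n.+2) : u < n.+1 -> e (r u) = u.
  by move=> lt; apply/val_inj; rewrite /= /r lt inordK.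
have re u : r (e u) = u by apply/val_inj; rewrite /= /r /= ltn_ord inordK.
have Ae u v : A u v -> A' (e u) (e v) by rewrite A'E => H; apply/orP; left.
have max_nbr u : A' ord_max u -> b /\ u = 0 :> nat.
  rewrite A'E => /orP[/(nadj_below below)|/andP[-> ]]; first by rewrite /= ltnn.
  by rewrite /joins /= => /andP[/eqP<-].
have max_nbr' u : A' u ord_max -> b /\ u = 0 :> nat.
  rewrite A'E => /orP[/(nadj_below below)|/andP[-> ]]; first by rewrite /= ltnn andbF.
  by rewrite /joins /= => /orP[/andP[/eqP<-]|] //.
have ltmax (u : 'I_n.+2) : u != ord_max -> u < n.+1.
  by move=> ne; rewrite ltn_neqAle -ltnS ltn_ord andbT.
have Ar u v : u != ord_max -> v != ord_max -> A' u v -> A (r u) (r v).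
  move=> /ltmax u1 /ltmax v1; rewrite A'E => /orP[|/andP[_]].
    by rewrite -[A _ _]/(nadj E m (r u) (r v)) /r u1 v1 !inordK.
  rewrite /joins /= => /orP[/andP[_ /eqP E1]|/andP[_ /eqP E1]].
    by rewrite -E1 ltnn in v1.
  by rewrite -E1 ltnn in u1.
have r0 (u : 'I_n.+2) : u = 0 :> nat -> r u = ord0.
  by move=> u0; apply/val_inj; rewrite /r u0 /= inordK.
have rmax : r ord_max = ord0 by rewrite /r /= ltnn.
split=> [[_ con acyc]|[bT [_ con acyc]]].
  split.
    (* The new vertex is joined to vertex 0 by a path, whose first edge can only be the pendant
       one. *)
    have /connectP[[|v p] /= ] := con ord_max ord0.
      by move=> _ /(congr1 val).
    by case/andP=> /max_nbr[].
  split=> // [u v|s us s2].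
    rewrite -(re u) -(re v); apply: connect_homo (con _ _) => x y.
    have [->|xm] := eqVneq x ord_max.
      by move=> /max_nbr[_ y0]; rewrite rmax (r0 y).
    have [->|ym] := eqVneq y ord_max.
      by move=> /max_nbr'[_ x0]; rewrite rmax (r0 x).
    by move=> axy; apply/connect1/Ar.
  apply/negP=> /(homo_cycle Ae); apply/negP; apply: acyc; rewrite ?size_map //.
  by rewrite map_inj_uniq //; apply: can_inj re.
split=> [|u v|s us s2]; first by rewrite !size_rcons sm.
  have c1 x : connect A' x (e (r x)) /\ connect A' (e (r x)) x.
    have [->|/ltmax/er->] := eqVneq x ord_max; last by [].
    rewrite rmax; split; apply: connect1; rewrite A'E bT /joins /= !eqxx ?orbT //.
  apply: connect_trans (c1 u).1 (connect_trans _ (c1 v).2).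
  by apply: connect_homo (con _ _) => x y /Ae /connect1.
apply/negP=> cyc; have [|nmax] := boolP (ord_max \in s).
  (* Once the cycle starts at the new vertex, its second and its last vertex are both 0, against
     uniqueness when it has more than two vertices. *)
  case/rot_to=> i p ip; move: cyc us s2.
  rewrite -(rot_cycle i) -(rot_uniq i) -(size_rot i) ip.
  case: p {ip} => // x p; case/lastP: p => // p y.
  rewrite /= rcons_path last_rcons => /andP[/max_nbr[_ x0]] /andP[_ /max_nbr'[_ y0]].
  have -> : x = y by apply/val_inj; rewrite /= x0 y0.
  by rewrite mem_rcons mem_head andbF.
have sm' : all (predC1 ord_max) s by apply/allP=> x xs /=; apply: contraNneq nmax => <-.
have := homo_cycle_in (P := predC1 ord_max) (f := r) _ sm' cyc.
move=> /(_ A) H; apply: (negP (acyc (map r s) _ _)).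
- rewrite map_inj_in_uniq // => x y /(allP sm') /= /ltmax/er {2}<- /(allP sm') /=.
  by move=> /ltmax/er {2}<- ->.
- by rewrite size_map.
- by apply: H => x y; apply: Ar.
Qed.

(** * The reduced instance *)


Definition pendants n k : seq (nat * nat) := mkseq (fun j => (0, j + n)) k.

Lemma edges_below_leq n n' E : n <= n' -> edges_below n E -> edges_below n' E.
Proof.
move=> le /allP H; apply/allP=> p /H /andP[a b].
by rewrite (leq_trans a le) (leq_trans b le).
Qed.

Lemma edges_below_pendants n k E : 0 < n -> edges_below n E ->
  edges_below (k + n) (E ++ pendants n k).
Proof.
move=> n0 H; rewrite /edges_below all_cat.
apply/andP; split; first exact: edges_below_leq (leq_addl _ _) H.
by apply/allP=> p /mapP[j]; rewrite mem_iota => jk -> /=; lia.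
Qed.

Lemma spanning_tree_pendants n E k M : 0 < n -> edges_below n E ->
  spanning_tree (k + n) (E ++ pendants n k) M <->
  exists2 m, M = m ++ nseq k true & spanning_tree n E m.
Proof.
move=> n0 below; elim: k M => [|k IH] M.
  rewrite cats0; split=> [H|[m -> H]]; last by rewrite cats0.
  by exists M; rewrite ?cats0.
rewrite /pendants mkseqS -rcons_cat -/(pendants n k).
have b' := edges_below_pendants k n0 below.
have kn : 0 < k + n by rewrite addn_gt0 n0 orbT.
have nS m : m ++ nseq k.+1 true = rcons (m ++ nseq k true) true.
  by rewrite -addn1 nseqD catA cats1.
split=> [H|[m -> H]].
  have [sM _ _] := H; case/lastP: M sM H => [|M b]; first by rewrite size_rcons.
  rewrite !size_rcons => -[sM] /(spanning_tree_pendant _ kn b' sM)[-> ].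
  by move/IH=> [m -> H]; exists m.
have H' : spanning_tree (k + n) (E ++ pendants n k) (m ++ nseq k true).
  by apply/IH; exists m.
rewrite nS; apply/spanning_tree_pendant => //; by case: H'.
Qed.

(** Without vertices there are no edges, and the empty mask is a spanning tree on no vertex,
    vacuously, as well as on a single one. This justifies giving an empty graph a vertex. *)
Lemma spanning_tree_pred n E m : edges_below n E ->
  spanning_tree n E m <-> spanning_tree n.-1.+1 E m.
Proof.
case: n => [|n _]; last by split.
case: E => [|p E] // _; split=> -[sm _ _]; split=> //.
- by move=> u v; rewrite !ord1.
- by move=> s /card_uniqP sE; rewrite -sE ltnNge (leq_trans (max_card _)) ?card_ord.
- by case.
- by case=> [|[]].
Qed.

Fixpoint arcs k (D : seq (nat * nat)) : seq (nat * nat) :=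
  if D is p :: D' then (p.1, k) :: (p.2, k) :: arcs k.+1 D' else [::].

Lemma arcs_rcons k D p :
  arcs k (rcons D p) = arcs k D ++ [:: (p.1, size D + k); (p.2, size D + k)].
Proof. by elim: D k => //= q D IH k; rewrite IH addnS. Qed.

Lemma size_arcs k D : size (arcs k D) = (size D).*2.
Proof. by elim: D k => //= p D IH k; rewrite IH. Qed.

Lemma mem_arcs k D a : a \in arcs k D ->
  (k <= a.2 < size D + k) && has (fun p => (a.1 == p.1) || (a.1 == p.2)) D.
Proof.
elim: D k => //= p D IH k; rewrite !inE => /or3P[/eqP->|/eqP->|/IH /andP[H ->]] /=.
- by rewrite eqxx leqnn /=; lia.
- by rewrite eqxx orbT leqnn /=; lia.
- by rewrite orbT andbT; lia.
Qed.

Lemma uniq_arcs k D : all (fun p => p.1 != p.2) D -> uniq (arcs k D).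
Proof.
elim: D k => //= p D IH k /andP[np /IH ->]; rewrite andbT inE negb_or xpair_eqE.
rewrite (negbTE np) /=; apply/andP; split;
  by apply/negP=> /mem_arcs /= /andP[]; rewrite ltnn.
Qed.

(** Taking [P] to be [predT] yields in-degrees, and membership in a tree yields [dep_count]. *)
Lemma count_arcs (P : pred nat) k D e :
  count (fun a => (a.2 == e) && P a.1) (arcs k D) =
  if k <= e < size D + k then
    P (nth (0, 0) D (e - k)).1 + P (nth (0, 0) D (e - k)).2 else 0.
Proof.
elim: D k => [|p D IH] k; first by rewrite add0n; case: ltngtP.
rewrite /= IH; have [<-|ne] := eqVneq k e.
  by rewrite leqnn subnn ltnn /= !addn0 addSn ltnS leq_addl.
have -> : (k <= e < (size D).+1 + k) = (k < e < size D + k.+1) by move: ne; lia.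
rewrite /= !add0n; case: ifP => // /andP[lt _].
by have -> : e - k = (e - k.+1).+1 by lia.
Qed.

(** Edge [j + m.+2] depends on the [j]-th pair of the extended [D] and has lower bound 1; the edges
    below [m.+2] have no dependency and lower bound 0. *)
Definition red (I : FInst) : GInst :=
  let n := (fn I).-1.+1 in
  let m := size (fE I) in
  let D := (m, m.+1) :: fD I in
  let d := size D in
  {| gn := d + n.+2;
     gE := fE I ++ pendants n d.+2;
     gA := arcs m.+2 D;
     gl := nseq m.+2 0 ++ nseq d 1;
     gu := nseq (d + m.+2) 2 |}.

Lemma simple_graph_below n E : simple_graph n E -> edges_below n E.
Proof. by case/andP=> H _; apply: sub_all H => p /and3P[-> ->]. Qed.

Lemma size_gE_red I : size (gE (red I)) = (size (fD I)).+1 + (size (fE I)).+2.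
Proof. by rewrite size_cat size_mkseq /=; lia. Qed.

Lemma simple_graph_pendants n n0 k E : n0 <= n -> 0 < n -> simple_graph n0 E ->
  simple_graph (k + n) (E ++ pendants n k).
Proof.
move=> le n0' sg; have below := edges_below_leq le (simple_graph_below sg).
case/andP: sg => sg1 sg2; apply/andP; split.
  rewrite all_cat; apply/andP; split.
    apply: sub_all sg1 => p /and3P[a b ->]; rewrite andbT; lia.
  by apply/allP=> p /mapP[j]; rewrite mem_iota => jk -> /=; lia.
rewrite map_cat cat_uniq sg2 /=; apply/andP; split.
  apply/hasPn=> _ /mapP[_ /mapP[j _ ->] -> /=]; apply/negP=> /mapP[p pE [_]].
  have /andP[a b] := allP below _ pE; rewrite max0n; lia.
rewrite -map_comp map_inj_uniq ?iota_uniq // => i j [_]; rewrite !max0n; lia.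
Qed.

(** Tails of arcs are thus below [(size (fE I)).+2] while heads start there, which excludes loops;
    distinct components make the arcs pairwise distinct. *)
Lemma red_pairs I : FInst_wf I ->
  all (fun p => [&& p.1 < (size (fE I)).+2, p.2 < (size (fE I)).+2 & p.1 != p.2])
    ((size (fE I), (size (fE I)).+1) :: fD I).
Proof.
case/andP=> _ /andP[H _]; rewrite /= !ltnS leqnn leqnSn /=.
apply/andP; split; first by rewrite neq_ltn ltnSn.
by apply: sub_all H => p /and3P[a b ->]; rewrite andbT; lia.
Qed.

Lemma red_wf I : FInst_wf I -> GInst_wf (red I).
Proof.
move=> wf; have pairs := red_pairs wf; case/andP: wf => sg _.
apply/and5P; split.
- have -> : gn (red I) = (size (fD I)).+3 + (fn I).-1.+1 by rewrite /=; lia.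
  by apply: simple_graph_pendants sg => //; lia.
- apply/allP=> a /mem_arcs /andP[/andP[a1 a2]] /hasP[p /(allP pairs)].
  rewrite size_gE_red => /and3P[p1 p2 _] /orP[]/eqP->; move: a1 a2 p1 p2 => /=; lia.
- by apply: uniq_arcs; apply: sub_all pairs => p /and3P[].
- by rewrite size_gE_red size_cat !size_nseq addnC.
- by rewrite size_gE_red size_nseq.
Qed.

Lemma red_star I : star_restr (red I).
Proof.
have indegE e : indeg (red I) e =
    if (size (fE I)).+2 <= e < (size (fD I)).+1 + (size (fE I)).+2 then 2 else 0.
  have := count_arcs predT (size (fE I)).+2
    ((size (fE I), (size (fE I)).+1) :: fD I) e.
  by rewrite /indeg => <-; apply: eq_count => a; rewrite andbT.
apply/and4P; split.
- by apply/allP=> k; rewrite mem_nseq => /andP[_ /eqP->].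
- by rewrite all_cat; apply/andP; split; apply/allP=> k;
    rewrite mem_nseq => /andP[_ /eqP->].
- by apply/allP=> e _; rewrite indegE; case: ifP.
- apply/hasP; exists (size (fE I)).+2; rewrite ?indegE ?leqnn ?mem_iota ?size_gE_red;
  by rewrite ?add0n ?leq_addl //= addSn ltnS leq_addl.
Qed.

(** The spanning trees of the new graph are those of the old one plus all pendant edges. On such a
    tree, [dep_count] at a pendant edge counts the members of its pair in the tree, so the lower
    bound 1 says exactly that the pair is met. *)
Lemma red_yes I : FInst_wf I -> FCST_yes I <-> GDCST_yes (red I).
Proof.
move=> wf; have pairs := red_pairs wf; case/andP: wf => sg sgD.
have below := simple_graph_below sg.
set n := (fn I).-1.+1; set m := size (fE I); set d := (size (fD I)).+1.
set D := (m, m.+1) :: fD I.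
have below' : edges_below n (fE I).
  by apply: edges_below_leq below; rewrite /n; lia.
have tree M : spanning_tree (gn (red I)) (gE (red I)) M <->
    exists2 T, M = T ++ nseq d.+2 true & spanning_tree (fn I) (fE I) T.
  have -> : gn (red I) = d.+2 + n by rewrite /= -/n /d; lia.
  apply: iff_trans (spanning_tree_pendants _ M _ below') _ => //.
  by split=> -[T ME /(spanning_tree_pred _ below) H]; exists T.
have depE M e : dep_count (red I) M e = if m.+2 <= e < d + m.+2 then
    nth false M (nth (0, 0) D (e - m.+2)).1 +
    nth false M (nth (0, 0) D (e - m.+2)).2 else 0.
  exact: (count_arcs (nth false M) m.+2 D e).
have glE e : e < d + m.+2 -> nth 0 (gl (red I)) e = (m.+2 <= e).
  rewrite nth_cat size_nseq !nth_nseq -[size (_ :: fD I)]/d -/m => lt.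
  clearbody m d.
  do !case: ifP; lia.
have guE e : e < d + m.+2 -> nth 0 (gu (red I)) e = 2.
  by move=> lt; rewrite nth_nseq lt.
have nthE T i : size T = m -> i < m ->
    nth false (T ++ nseq d.+2 true) i = nth false T i.
  by move=> sT lt; rewrite nth_cat sT lt.
have nthP T i : size T = m -> m <= i < d.+2 + m ->
    nth false (T ++ nseq d.+2 true) i.
  move=> sT lt; rewrite nth_cat sT nth_nseq; clearbody m d; do !case: ifP; lia.
have Dm p : p \in fD I -> (p.1 < m) && (p.2 < m).
  by move=> pD; have /and3P[-> ->] := allP (andP sgD).1 _ pD.
split=> [[T [st hit]]|[M [/tree[T ME st] sat]]].
  have [sT _ _] := st.
  exists (T ++ nseq d.+2 true); split; first by apply/tree; exists T.
  move=> e; rewrite size_gE_red -/d -/m => lt _.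
  rewrite depE glE // guE // lt andbT; case: leqP => //= le.
  have : nth (0, 0) D (e - m.+2) \in D.
    by apply: mem_nth; rewrite -[size D]/d ltn_subLR // addnC.
  case: (nth _ D _) => a b.
  rewrite inE => /orP[/eqP[-> ->]|pD].
    (* The prepended pair consists of two pendant edges, both in the tree. *)
    by rewrite !nthP //=; clearbody m d; lia.
  have /andP[/= a1 b1] := Dm _ pD; rewrite !nthE //.
  by have /= := hit _ pD; do 2!case: nth.
have [sT _ _] := st; exists T; split=> // p pD.
have /andP[a1 b1] := Dm _ pD.
have iD : index p (fD I) < size (fD I) by rewrite index_mem.
(* The successor skips the pair prepended to [fD I]. *)
have lte : (index p (fD I)).+1 + m.+2 < d + m.+2 by rewrite ltn_add2r.
have := sat ((index p (fD I)).+1 + m.+2); rewrite size_gE_red => /(_ lte).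
rewrite depE glE // guE // lte addnK leq_addl [nth _ D _]/= nth_index // ME.
rewrite [nth _ _ (_ + _)]nthP ?nthE //; last by move: lte; clearbody m d; lia.
by move=> /(_ isT) /andP[]; do 2!case: nth.
Qed.

(** * Encodings *)


Lemma enc_nat_cat k s : enc_nat k ++ s = ones k (false :: s).
Proof. by rewrite /enc_nat cat_rcons cat_nseq. Qed.

Lemma num_enc k s : num (enc_nat k ++ s) = k.
Proof. by rewrite enc_nat_cat; elim: k => //= k ->. Qed.

Lemma rest_enc k s : rest (enc_nat k ++ s) = s.
Proof. by rewrite enc_nat_cat; elim: k. Qed.

Lemma catrev_enc k s : catrev (enc_nat k) s = false :: ones k s.
Proof. by rewrite catrevE rev_rcons rev_nseq /= cat_nseq. Qed.

Lemma enc_seq_cons k l : enc_seq (k :: l) = enc_nat k ++ enc_seq l.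
Proof. by []. Qed.

Lemma enc_seq_cat l l' : enc_seq (l ++ l') = enc_seq l ++ enc_seq l'.
Proof. by rewrite /enc_seq map_cat flatten_cat. Qed.

Lemma enc_seq_inj : injective enc_seq.
Proof.
have nN k s : enc_nat k ++ s <> [::] by case: k.
elim=> [|a l IH] [|b l'] //; [by move/esym/nN | by move/nN |].
rewrite !enc_seq_cons => E; have := congr1 num E; rewrite !num_enc => ->.
by have := congr1 rest E; rewrite !rest_enc => e; rewrite (IH _ e).
Qed.

Lemma pairs_flat_cat s t : pairs_flat (s ++ t) = pairs_flat s ++ pairs_flat t.
Proof. by rewrite /pairs_flat map_cat flatten_cat. Qed.

Lemma pairs_flat_rcons s p : pairs_flat (rcons s p) = pairs_flat s ++ [:: p.1; p.2].
Proof. by rewrite -cats1 pairs_flat_cat. Qed.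

Lemma size_pairs_flat s : size (pairs_flat s) = (size s).*2.
Proof. by elim: s => //= p s ->. Qed.

Lemma pairs_flat_inj : injective pairs_flat.
Proof. by elim=> [|[a b] s IH] [|[c d] t] //= [-> -> /IH ->]. Qed.

Lemma cat_inj (T : eqType) (s1 s2 t1 t2 : seq T) : size s1 = size t1 ->
  s1 ++ s2 = t1 ++ t2 -> s1 = t1 /\ s2 = t2.
Proof. by move=> ss /eqP; rewrite eqseq_cat // => /andP[/eqP-> /eqP->]. Qed.

Lemma encF_inj : injective encF.
Proof.
move=> [n E D] [n' E' D'] /enc_seq_inj /= [-> sE /cat_inj[]].
  by rewrite !size_pairs_flat sE.
by move=> /pairs_flat_inj -> [_ /pairs_flat_inj ->].
Qed.

(** The bounds are written without their lengths; well-formedness fixes these to the number of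
    edges, which is what separates [gl] from [gu]. The reduction needs this because membership of a
    code is witnessed by some instance, not by [red I] itself. *)
Lemma encG_inj I I' : GInst_wf I -> GInst_wf I' -> encG I = encG I' -> I = I'.
Proof.
case: I I' => [n E A l u] [n' E' A' l' u'].
move=> /and5P[_ _ _ /= /eqP sl _] /and5P[_ _ _ /= /eqP sl' _].
move=> /enc_seq_inj /= [-> sE /cat_inj[]]; first by rewrite !size_pairs_flat sE.
move=> /pairs_flat_inj -> [sA /cat_inj[]]; first by rewrite !size_pairs_flat sA.
by move=> /pairs_flat_inj -> /cat_inj[]; [rewrite sl sl' sE | move=> -> ->].
Qed.

Lemma read_pairs_enc E l acc :
  iter (size E) read_pair (enc_seq (pairs_flat E ++ l), acc) =
  (enc_seq l, catrev (enc_seq (pairs_flat E)) acc).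
Proof.
(* Induction from the right, because [iter] exposes its last round. *)
elim/last_ind: E l => // E p IH l; rewrite size_rcons /= pairs_flat_rcons -catA IH.
rewrite [in RHS]enc_seq_cat catrev_catl /read_pair /= !enc_seq_cons.
rewrite num_enc !rest_enc num_enc -!catrev_enc.
by rewrite -catrev_catl cats0.
Qed.

Lemma arc_steps_enc m D l acc :
  iteri (size D) (arc_step m) (enc_seq (pairs_flat D ++ l), acc) =
  (enc_seq l, catrev (enc_seq (pairs_flat (arcs m D))) acc).
Proof.
elim/last_ind: D l => // D p IH l; rewrite size_rcons /= pairs_flat_rcons -catA IH.
rewrite arcs_rcons pairs_flat_cat [in RHS]enc_seq_cat catrev_catl /arc_step /= !enc_seq_cons.
rewrite num_enc !rest_enc num_enc -!catrev_enc.
by rewrite -!catrev_catl !catA cats0.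
Qed.

Lemma pendant_steps_enc n k acc :
  iteri k (pendant_step n) acc = catrev (enc_seq (pairs_flat (pendants n k))) acc.
Proof.
elim: k => // k IH; rewrite [LHS]/= IH.
rewrite /pendants mkseqS pairs_flat_rcons enc_seq_cat catrev_catl !enc_seq_cons.
by rewrite !catrev_catl !catrev_enc.
Qed.

(** The two pendant edges added before the loop are rounds 0 and 1 of a single longer iteration. *)
Lemma pendant_steps_shift n k acc :
  iteri k (pendant_step n.+2) (pendant_step n 1 (pendant_step n 0 acc)) =
  iteri k.+2 (pendant_step n) acc.
Proof. by elim: k => //= k ->; rewrite /pendant_step !addnS !addSn. Qed.

Lemma enc_nseq j k s :
  enc_seq (nseq k j) ++ s = iter k (cat (enc_nat j)) s.
Proof. by elim: k => //= k <-; rewrite enc_seq_cons catA. Qed.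

Lemma iter_double k s :
  iter k (cat [:: true; true]) (false :: s) = enc_nat k.*2 ++ s.
Proof. by rewrite enc_nat_cat; elim: k => //= k ->. Qed.

Lemma encGE I : encG I =
  enc_nat (gn I) ++ enc_nat (size (gE I)) ++ enc_seq (pairs_flat (gE I)) ++
  enc_nat (size (gA I)) ++ enc_seq (pairs_flat (gA I)) ++
  enc_seq (gl I) ++ enc_seq (gu I).
Proof.
by rewrite /encG; do ![rewrite enc_seq_cat | rewrite enc_seq_cons]; rewrite cats0 -!catA.
Qed.

Lemma reduction_enc I : reduction (encF I) = encG (red I).
Proof.
rewrite /reduction /encF [_ ++ _]/= !enc_seq_cons; cbv zeta.
rewrite num_enc !rest_enc !num_enc read_pairs_enc; cbn [fst snd].
rewrite enc_seq_cons num_enc rest_enc.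
set m := size (fE I); set n := (fn I).-1.+1; set d := (size (fD I)).+1.
set D := (m, m.+1) :: fD I.
(* With the pushed pair in front, the unread input is the code of the extended [D]. *)
have -> : ones m (false :: ones m.+1 (false :: enc_seq (pairs_flat (fD I)))) =
    enc_seq (pairs_flat D ++ [::]).
  by rewrite cats0 -enc_nat_cat -enc_nat_cat.
rewrite (arc_steps_enc _ D) pendant_steps_shift pendant_steps_enc -catrev_catl.
rewrite -!enc_nat_cat iter_double.
rewrite -[iter _ (cat [:: true; true; false]) _](enc_nseq 2).
rewrite -[iter _ (cat [:: true; false]) _](enc_nseq 1).
have -> X : ncons m.+2 false X = enc_seq (nseq m.+2 0) ++ X.
  by rewrite enc_nseq; elim: m.+2 => //= k ->.
cbn [fst snd]; rewrite !catrevE !cats0 rev_cat !revK.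
rewrite encGE size_gE_red [size (gA _)]size_arcs.
have -> : enc_seq (pairs_flat (gE (red I))) =
    enc_seq (pairs_flat (fE I)) ++ enc_seq (pairs_flat (pendants n d.+2)).
  by rewrite -enc_seq_cat -pairs_flat_cat.
have -> X : enc_seq (gl (red I)) ++ X =
    enc_seq (nseq m.+2 0) ++ enc_seq (nseq d 1) ++ X.
  by rewrite catA -enc_seq_cat.
by rewrite -rev_cat revK.
Qed.

Theorem theorem8 :
  exists f : seq bool -> seq bool,
    poly_time_computable f /\
    forall x, FCST_valid x ->
      GDCSTstar_valid (f x) /\ (FCST_lang x <-> GDCSTstar_lang (f x)).
Proof.
exists reduction; split.
  apply: (@poly_time_srun 8 (pQ (compile reduction_prog))
    (pcode (p := compile reduction_prog)) (pstart (compile reduction_prog)) _ 1000 1).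
    exact: uses_compile uses_reduction_prog.
  by move=> x; have [ss' [H]] := runs_reduction x; exists ss'.
move=> x [I [wf ->]]; rewrite reduction_enc; split.
  by exists (red I); split=> //; [exact: red_wf | exact: red_star].
split=> [[I' [wf' /encF_inj <- /(red_yes wf) yes]]|[J [wfJ _ eJ yes]]].
  by exists (red I); split=> //; [exact: red_wf | exact: red_star].
exists I; split=> //; apply/(red_yes wf).
by rewrite (encG_inj (red_wf wf) wfJ eJ).
Qed.
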